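(* Let $\lambda\in\mathbb{R}$. A $\lambda$-translator in $\mathrm{Nil}_3$ invariant by vertical translations is a vertical cylinder $\pi^{-1}(\alpha)$ over a circle $\alpha\subset\mathbb{R}^2$ of constant curvature $\kappa_\alpha=2\lambda$.
   Context: The Heisenberg space $\mathrm{Nil}_3$ is $\mathbb{R}^3$ with coordinates $(x,y,z)$ and metric $\langle\cdot,\cdot\rangle=dx^2+dy^2+(dz+\tau(y\,dx-x\,dy))^2$, where $\tau$ is a fixed constant. The mean curvature $H$ is half the trace of the second fundamental form with respect to the unit normal $N$. Given $\lambda\in\mathbb{R}$, an oriented surface $M$ in $\mathrm{Nil}_3$ is a $\lambda$-translator if $H(p)=\langle N(p),\partial_z\rangle+\lambda$ for all $p\in M$. Vertical translations are the isometries $(x,y,z)\mapsto(x,y,z+t)$, $t\in\mathbb{R}$. The map $\pi:\mathrm{Nil}_3\to\mathbb{R}^2$ is $\pi(x,y,z)=(x,y)$; for a curve $\alpha\subset\mathbb{R}^2$, the vertical cylinder over $\alpha$ is $\pi^{-1}(\alpha)$, and $\kappa_\alpha$ is the curvature of $\alpha$.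
   Formalization: The surface is assumed connected (two disjoint cylinders are a counterexample); the cylinder is over an open arc of the circle, and over the whole circle if the surface is closed in Nil_3 (a cylinder over a proper arc is a counterexample); for λ=0 the circle means a straight line. *)

(* Defs.v *)
From mathcomp Require Import all_boot all_order all_algebra.
From mathcomp Require Import all_classical all_reals all_analysis.

Set Implicit Arguments.
Unset Strict Implicit.
Unset Printing Implicit Defensive.

Import Order.TTheory GRing.Theory Num.Theory.
Import numFieldNormedType.Exports.

Local Open Scope classical_set_scope.
Local Open Scope ring_scope.

(* Points of Nil_3, and tangent vectors in the coordinate frame d/dx, d/dy,    *)
(* d/dz, are row vectors of size 3; points of the plane and of parameter       *)
(* domains are row vectors of size 2. The library norm on row vectors is the   *)
(* sup norm: it only serves for the topology and for derivatives, lengths      *)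
(* being computed with the inner products below.                               *)

Definition basis_vec (R : realType) (n : nat) (i : 'I_n) : 'rV[R]_n :=
  delta_mx 0 i.

Definition contact_form (R : realType) (tau : R) (p v : 'rV[R]_3) : R :=
  v 0 2 + tau * (p 0 1 * v 0 0 - p 0 0 * v 0 1).

Definition nil_metric (R : realType) (tau : R) (p v w : 'rV[R]_3) : R :=
  v 0 0 * w 0 0 + v 0 1 * w 0 1 + contact_form tau p v * contact_form tau p w.

Definition nil_gram (R : realType) (tau : R) (p : 'rV[R]_3) : 'M[R]_3 :=
  \matrix_(i, j) nil_metric tau p (basis_vec R i) (basis_vec R j).

(* Gamma^k_(ij) of the Levi-Civita connection *)
Definition christoffel (R : realType) (tau : R) (p : 'rV[R]_3)
    (k i j : 'I_3) : R :=
  let dg (m a b : 'I_3) : R :=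
    'D_(basis_vec R m) (fun q : 'rV[R]_3 => nil_gram tau q a b : R^o) p in
  2^-1 * \sum_l invmx (nil_gram tau p) k l * (dg i j l + dg j i l - dg l i j).

Definition partial (R : realType) (m : nat) (i : 'I_2)
    (f : 'rV[R]_2 -> 'rV[R]_m.+1) : 'rV[R]_2 -> 'rV[R]_m.+1 :=
  'D_(basis_vec R i) f.

Definition C1_on (R : realType) (m : nat) (U : set 'rV[R]_2)
    (f : 'rV[R]_2 -> 'rV[R]_m.+1) : Prop :=
  forall u, U u -> differentiable f u /\
    forall i, {for u, continuous (partial i f)}.

Definition C2_on (R : realType) (m : nat) (U : set 'rV[R]_2)
    (f : 'rV[R]_2 -> 'rV[R]_m.+1) : Prop :=
  C1_on U f /\ forall i, C1_on U (partial i f).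

Definition immersion_on (R : realType) (U : set 'rV[R]_2)
    (X : 'rV[R]_2 -> 'rV[R]_3) : Prop :=
  forall u, U u -> row_free (\matrix_(i < 2) partial i X u).

(* covariant derivative, along d/du_i, of a vector field Y along X *)
Definition covariant_deriv (R : realType) (tau : R)
    (X Y : 'rV[R]_2 -> 'rV[R]_3) (i : 'I_2) (u : 'rV[R]_2) : 'rV[R]_3 :=
  \row_k (partial i Y u 0 k
    + \sum_a \sum_b christoffel tau (X u) k a b * partial i X u 0 a * Y u 0 b).

Definition first_form (R : realType) (tau : R) (X : 'rV[R]_2 -> 'rV[R]_3)
    (u : 'rV[R]_2) : 'M[R]_2 :=
  \matrix_(i, j) nil_metric tau (X u) (partial i X u) (partial j X u).

Definition second_form (R : realType) (tau : R) (X : 'rV[R]_2 -> 'rV[R]_3)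
    (n : 'rV[R]_3) (u : 'rV[R]_2) : 'M[R]_2 :=
  \matrix_(i, j)
    nil_metric tau (X u) (covariant_deriv tau X (partial j X) i u) n.

(* The trace is taken with respect to the induced metric. *)
Definition mean_curvature (R : realType) (tau : R) (X : 'rV[R]_2 -> 'rV[R]_3)
    (n : 'rV[R]_3) (u : 'rV[R]_2) : R :=
  2^-1 * \tr (invmx (first_form tau X u) *m second_form tau X n u).

(* An immersed surface is given by a topological surface T and a map F from T  *)
(* to Nil_3 which is a C^2 immersion when read in suitable local               *)
(* parametrizations phi of T. No atlas is needed as a separate datum: any two  *)
(* parametrizations that turn F into a C^2 immersion differ by a C^2           *)
(* diffeomorphism, by the inverse function theorem. Embedded surfaces are the  *)
(* case where T is a subset of Nil_3 and F the inclusion.                      *)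
Definition local_param (R : realType) (T : topologicalType)
    (F : T -> 'rV[R]_3) (U : set 'rV[R]_2) (phi : 'rV[R]_2 -> T) : Prop :=
  [/\ open U, {in U, continuous phi}, {in U &, injective phi},
      (forall V, V `<=` U -> open V -> open (phi @` V)) &
      C2_on U (F \o phi) /\ immersion_on U (F \o phi)].

Record oriented_surface (R : realType) (tau : R) (T : topologicalType)
    (F N : T -> 'rV[R]_3) : Prop := OrientedSurface {
  surface_nonempty : [set: T] !=set0;
  surface_connected : connected [set: T];
  surface_hausdorff : hausdorff_space T;
  surface_second_countable : @second_countable T;
  surface_param : forall q : T, exists U phi,
    local_param F U phi /\ (phi @` U) q;
  normal_continuous : continuous N;
  normal_unit : forall q, nil_metric tau (F q) (N q) (N q) = 1;
  normal_orthogonal : forall U phi, local_param F U phi ->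
    forall u, U u -> forall i : 'I_2,
      nil_metric tau (F (phi u)) (partial i (F \o phi) u) (N (phi u)) = 0 }.

Definition translator (R : realType) (tau lambda : R) (T : topologicalType)
    (F N : T -> 'rV[R]_3) : Prop :=
  forall U phi, local_param F U phi -> forall u, U u ->
    mean_curvature tau (F \o phi) (N (phi u)) u =
    nil_metric tau (F (phi u)) (N (phi u)) (basis_vec R 2) + lambda.

Definition vertical_translation (R : realType) (t : R) (p : 'rV[R]_3) :
    'rV[R]_3 := p + t *: basis_vec R 2.

Definition vertically_invariant (R : realType) (M : set 'rV[R]_3) : Prop :=
  forall t, vertical_translation t @` M = M.

(* being linear, it is also the expression of its own differential *)
Definition nil_proj (R : realType) (p : 'rV[R]_3) : 'rV[R]_2 :=
  \row_(i < 2) p 0 (widen_ord (leqnSn 2) i).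

Definition vertical_cylinder (R : realType) (alpha : set 'rV[R]_2) :
    set 'rV[R]_3 := @nil_proj R @^-1` alpha.

Definition dot2 (R : realType) (v w : 'rV[R]_2) : R :=
  v 0 0 * w 0 0 + v 0 1 * w 0 1.

Definition rot90 (R : realType) (v : 'rV[R]_2) : 'rV[R]_2 :=
  \row_i (if i == 0 then - v 0 1 else v 0 0).

Definition arclength_curve (R : realType) (a : R -> 'rV[R]_2) : Prop :=
  forall s, [/\ derivable a s 1, derivable (derive1 a) s 1 &
                dot2 (derive1 a s) (derive1 a s) = 1].

(* signed curvature, for an arc-length parametrization *)
Definition curvature (R : realType) (a : R -> 'rV[R]_2) (s : R) : R :=
  dot2 (derive1n 2 a s) (rot90 (derive1 a s)).

Definition round_circle (R : realType) (c : 'rV[R]_2) (r : R) : set 'rV[R]_2 :=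
  [set q | dot2 (q - c) (q - c) = r ^+ 2].

Definition straight_line (R : realType) (q v : 'rV[R]_2) : set 'rV[R]_2 :=
  [set q + s *: v | s in [set: R]].

(* A circle of curvature 0 is a straight line. *)
Definition circle_of_curvature (R : realType) (k : R) (C : set 'rV[R]_2) :
    Prop :=
  (k != 0 -> exists c, C = round_circle c `|k|^-1) /\
  (k = 0 -> exists q v, v != 0 /\ C = straight_line q v).

(* Main.v *)
Require Import Defs.
From HB Require Import structures.
From mathcomp Require Import all_boot all_order all_algebra ring lra.
From mathcomp Require Import all_classical all_reals all_analysis.
Set Implicit Arguments.
Unset Strict Implicit.
Unset Printing Implicit Defensive.
Import Order.TTheory GRing.Theory Num.Theory.
Import numFieldNormedType.Exports.
Local Open Scope classical_set_scope.
Local Open Scope ring_scope.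

(* The surface projects to a set P of the plane with range F = P x R. The     *)
(* projection has nowhere rank 2: otherwise a C^1 embedded cube would lie in   *)
(* range F, which is a countable union of Lipschitz images of squares, and by  *)
(* Baire one of these images would contain a cube, against a count of grid     *)
(* points. Hence d/dz is tangent, the normal N is horizontal with planar part  *)
(* n, and H = lambda. Writing g for the projection of F, the rank condition    *)
(* and the symmetry of second derivatives turn the mean curvature equation     *)
(* into dn = - k dg with k = 2 lambda. By connectedness n + k g is constant,   *)
(* and so is k |g|^2 - 2 (n + k g).g: g stays on one circle of curvature k (or *)
(* on one line when k = 0). Its image is open in that curve by the             *)
(* intermediate value theorem along a chart, and connected.                    *)

(** Write g for the planar projection of F, n for the planar part of N, and k = 2 lambda.

    Invariance is assumed for the image only, so it does not directly say that d/dz is tangent to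
    each sheet. [planar_rank_lt2] supplies this. If g had rank 2 somewhere, the vertical translates
    of that sheet would put into range F a copy of a cube under a map that contracts distances at
    most by a fixed factor. But range F is a countable union of compact Lipschitz images of squares:
    [Baire_cover] finds a smaller cube inside one of them, and [no_cube_in_square] excludes that by
    counting points.

    Once g has rank at most 1, [vertical_tangency] makes N horizontal, so the translator equation
    becomes H = lambda. By [mean_curvature_vertical] the second derivatives of g paired with n are
    then k times the square of dg, all terms in tau having dropped out of the trace.
    [normal_translate] converts this into dn = - k dg, so n + k g is constant on the connected
    surface ([global_translate]). With W this constant, the differential of k |g|^2 - 2 W.g is - 2
    n.dg = 0 ([global_quadric]). Hence g stays on a single conic [on_conic], a circle of curvature k
    or a line, which [circle_arc] parametrizes by arc length.

    It remains to see which part of the curve is reached. The set of parameters reached is open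
    ([open_preimage], which rests on [tangential_surjective] and [conic_unique]), and connectedness
    of the surface makes it an interval, within one period when k is nonzero ([flat_interval],
    [arc_interval]). It is closed when range F is, and then the whole curve is reached
    ([image_interval]). Since range F consists of full fibres ([range_fiber]), it is the cylinder
    over that arc. *)

Section Plane_calculus.
Variable R : realType.
Implicit Types (f : 'rV[R]_2 -> R) (u v w : 'rV[R]_2).

Definition pd (i : 'I_2) (f : 'rV[R]_2 -> R) : 'rV[R]_2 -> R :=
  'D_(basis_vec R i) f.

Lemma row2_basis w : w = w 0 0 *: basis_vec R 0 + w 0 1 *: basis_vec R 1.
Proof.
apply/rowP => i; rewrite /basis_vec !mxE !eqxx /=.
by case: i => -[|[|//]] p; rewrite !(mulr1, mulr0, addr0, add0r) //=;
  congr (w _ _); apply/val_inj.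
Qed.

Lemma is_derive_line f u w (s : R) : differentiable f (u + s *: w) ->
  is_derive s 1 (fun r : R => f (u + r *: w))
    (w 0 0 * pd 0 f (u + s *: w) + w 0 1 * pd 1 f (u + s *: w)).
Proof.
move=> df.
set l := fun r : R => u + r *: w.
have dl : is_derive s 1 l w.
  have lE : (fun h : R => h^-1 *: ((l \o shift s) (h *: 1) - l s)) @ 0^' --> w.
    apply: cvg_near_cst; near=> h.
    have h0 : h != 0 by near: h; exact: nbhs_dnbhs_neq.
    have -> : (l \o shift s) (h *: 1) - l s = h *: w.
      by apply/rowP => i; rewrite !mxE /GRing.scale /=; ring.
    by rewrite scalerA mulVf // scale1r.
  by apply: DeriveDef; [apply/cvg_ex; exists w|exact/cvg_lim].
have ddl : differentiable l s by apply/derivable1_diffP; case: dl.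
have dc : differentiable (f \o l) s by exact: differentiable_comp.
apply: DeriveDef; first exact/derivable1_diffP.
rewrite deriveE // diff_comp //= -[X in 'd f _ X](@deriveE _ _ _ l s 1) // derive_val.
have dlin x : 'd f (u + s *: w) x = x 0 0 * pd 0 f (u + s *: w) + x 0 1 * pd 1 f (u + s *: w).
  by rewrite [in LHS](row2_basis x) linearD !linearZ /= /pd !(deriveE _ df).
exact: dlin.
Unshelve. all: by end_near. Qed.

Lemma coord_le_norm (n : nat) (w : 'rV[R]_n.+1) i : `|w 0 i| <= `|w|.
Proof.
rewrite [leRHS]/Num.Def.normr/= mx_normrE.
exact: (le_bigmax _ (fun i : 'I_1 * 'I_n.+1 => `|w i.1 i.2|) (0, i)).
Qed.

Lemma norm_le_coord (n : nat) (w : 'rV[R]_n.+1) (M : R) :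
  0 <= M -> (forall i, `|w 0 i| <= M) -> `|w| <= M.
Proof.
move=> M0 wM; rewrite [leLHS]/Num.Def.normr/= mx_normrE; apply: bigmax_le => // -[i j] _ /=.
by rewrite ord1.
Qed.

Lemma ball_convex n (u v c : 'rV[R]_n.+1) (r s : R) : ball c r u -> ball c r v -> 0 <= s <= 1 ->
  ball c r (v + s *: (u - v)).
Proof.
rewrite -ball_normE /= => cu cv /andP[s0 s1].
have -> : c - (v + s *: (u - v)) = (1 - s) *: (c - v) + s *: (c - u).
  by rewrite !scalerBr !scalerBl !scale1r; apply/rowP => i; rewrite !mxE; ring.
apply: le_lt_trans (ler_normD _ _) _; rewrite !normrZ ger0_norm ?subr_ge0 // ger0_norm //.
have [->|sn] := eqVneq s 0; first by rewrite subr0 mul1r mul0r addr0.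
rewrite [ltRHS](_ : r = (1 - s) * r + s * r); last by ring.
apply: ler_ltD; first by rewrite ler_wpM2l ?subr_ge0 // ltW.
by rewrite ltr_pM2l // lt_def sn.
Qed.

Lemma line_MVT f u v : (forall s : R, 0 <= s <= 1 -> differentiable f (v + s *: (u - v))) ->
  exists2 s : R, 0 <= s <= 1 & f u - f v =
    (u - v) 0 0 * pd 0 f (v + s *: (u - v)) + (u - v) 0 1 * pd 1 f (v + s *: (u - v)).
Proof.
move=> df.
have D s : 0 <= s <= 1 -> _ := fun h => is_derive_line (df s h).
have [||s sI] := @MVT_segment R (fun r : R => f (v + r *: (u - v)))
  (fun s => (u - v) 0 0 * pd 0 f (v + s *: (u - v)) + (u - v) 0 1 * pd 1 f (v + s *: (u - v)))
  0 1 ler01.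
- by move=> s; rewrite in_itv /= => /andP[s0 s1]; apply: D; rewrite !ltW.
- apply: derivable_within_continuous => s; rewrite in_itv /= => sI.
  by have [] := D s sI.
rewrite scale1r scale0r addr0 subr0 mulr1 (addrC v) subrK => E.
by exists s => //; move: sI; rewrite in_itv.
Qed.

Let lincomb_bound (x y p q p' q' w e : R) : `|x| <= w -> `|y| <= w ->
  `|p' - p| < e / 2 -> `|q' - q| < e / 2 ->
  `|x * p + y * q - (x * p' + y * q')| <= e * w.
Proof.
move=> xw yw pe qe; rewrite distrC.
have -> : x * p' + y * q' - (x * p + y * q) = x * (p' - p) + y * (q' - q) by ring.
apply: le_trans (ler_normD _ _) _; rewrite !normrM.
have -> : e * w = w * (e / 2) + w * (e / 2) by field.
by apply: lerD; apply: ler_pM => //; apply: ltW.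
Qed.

(** Mean value theorem on the segment from v to u: both partial derivatives at the intermediate
    point are within e / 2 of their values at u0. Having u and v both free is what later yields
    Lipschitz and expansion bounds. *)
Lemma strict_diff f u0 (r e : R) : 0 < r -> 0 < e ->
  (forall u, ball u0 r u -> differentiable f u) ->
  (forall i, {for u0, continuous (pd i f)}) ->
  exists2 d : R, 0 < d <= r & forall u v, ball u0 d u -> ball u0 d v ->
    `|f u - f v - ((u - v) 0 0 * pd 0 f u0 + (u - v) 0 1 * pd 1 f u0)| <= e * `|u - v|.
Proof.
move=> r0 e0 df cf.
have e20 : 0 < e / 2 by rewrite divr_gt0.
have near i : \forall u \near u0, `|pd i f u0 - pd i f u| < e / 2.
  by have /cvgrPdist_lt/(_ _ e20) := cf i.
have /nbhs_ballP[d /= d0 dP] : \forall u \near u0, `|pd 0 f u0 - pd 0 f u| < e / 2 /\ `|pd 1 f u0 - pd 1 f u| < e / 2.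
  exact: (filterI (near 0) (near 1)).
have mr : Num.min d r <= r by rewrite ge_min lexx orbT.
have md : Num.min d r <= d by rewrite ge_min lexx.
exists (Num.min d r); first by rewrite lt_min d0 r0 /= ge_min lexx orbT.
move=> u v bu bv.
have inb s : 0 <= s <= 1 -> ball u0 (Num.min d r) (v + s *: (u - v)) by exact: ball_convex.
have [s sI ->] := @line_MVT f u v (fun s sI => df _ (le_ball mr (inb s sI))).
have [p0 p1] := dP _ (le_ball md (inb s sI)).
set x := v + _ in p0 p1 *.
exact: (lincomb_bound (coord_le_norm (u - v) 0) (coord_le_norm (u - v) 1) p0 p1).
Qed.

Lemma norm_basis_le (i : 'I_2) : `|basis_vec R i| <= 1.
Proof.
rewrite [leLHS]/Num.Def.normr/= mx_normrE; apply: bigmax_le => // -[a b] _ /=.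
by rewrite /basis_vec mxE; case: (_ && _); rewrite ?normr1 ?normr0.
Qed.

Lemma basis_line (i : 'I_2) f u (h : R) :
  (h *: basis_vec R i) 0 0 * pd 0 f u + (h *: basis_vec R i) 0 1 * pd 1 f u = h * pd i f u.
Proof.
rewrite /basis_vec !mxE !eqxx /=; case: i => -[|[|//]] p;
 rewrite !(mulr1, mulr0, mul0r, addr0, add0r) //=; congr (_ * pd _ _ _); exact/val_inj.
Qed.

(** The mean value theorem in direction i turns the second difference of f into h times an increment
    of [fi] in direction j, which strict differentiability of [fi] evaluates. *)
Lemma second_difference f fi u0 (r e : R) (i j : 'I_2) : 0 < r -> 0 < e ->
  (forall u, ball u0 r u -> [/\ differentiable f u, pd i f u = fi u & differentiable fi u]) ->
  (forall k, {for u0, continuous (pd k fi)}) ->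
  exists2 d : R, 0 < d & forall h : R, 0 < h < d ->
   `|f (u0 + h *: basis_vec R j + h *: basis_vec R i) - f (u0 + h *: basis_vec R i)
     - (f (u0 + h *: basis_vec R j) - f u0) - h * (h * pd j fi u0)| <= e * h * h.
Proof.
move=> r0 e0 df cf.
have [d /andP[d0 dr] dP] := strict_diff r0 e0 (fun u bu => let: And3 _ _ c := df u bu in c) cf.
exists (d / 2); first by rewrite divr_gt0.
move=> h /andP[h0 hd].
have inb (a s : R) : 0 <= a <= h -> 0 <= s <= h -> ball u0 d (u0 + a *: basis_vec R j + s *: basis_vec R i).
  move=> /andP[a0 ah] /andP[s0 sh]; rewrite -ball_normE /=.
  have -> : u0 - (u0 + a *: basis_vec R j + s *: basis_vec R i) = - (a *: basis_vec R j + s *: basis_vec R i).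
    by rewrite -addrA opprD addrA subrr add0r.
  rewrite normrN; apply: le_lt_trans (ler_normD _ _) _; rewrite !normrZ !ger0_norm //.
  rewrite (splitr d); apply: ltr_leD; last first.
    by apply: le_trans (ltW hd); rewrite -[leRHS]mulr1 ler_pM // norm_basis_le.
  by apply: le_lt_trans hd; rewrite -[leRHS]mulr1 ler_pM // norm_basis_le.
have hh : 0 <= h <= h by rewrite lexx ltW.
have h00 : (0 : R) <= 0 <= h by rewrite lexx ltW.
have D (a s : R) : 0 <= a <= h -> 0 <= s <= h -> is_derive s 1
    (fun s : R => f (u0 + a *: basis_vec R j + s *: basis_vec R i))
    (fi (u0 + a *: basis_vec R j + s *: basis_vec R i)).
  move=> aI sI.
  have [dfa <- _] := df _ (le_ball dr (inb a s aI sI)); move: dfa => /is_derive_line.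
  by have := basis_line i f (u0 + a *: basis_vec R j + s *: basis_vec R i) 1; rewrite scale1r mul1r => ->.
pose G (a s : R) := f (u0 + a *: basis_vec R j + s *: basis_vec R i).
pose g (a s : R) := fi (u0 + a *: basis_vec R j + s *: basis_vec R i).
have DG s : 0 <= s <= h -> is_derive s 1 (G h - G 0) (g h s - g 0 s).
  by move=> sI; apply: is_deriveB; exact: D.
have [||s sI] := @MVT_segment R (G h - G 0) (fun s => g h s - g 0 s) 0 h (ltW h0).
- by move=> s; rewrite in_itv /= => /andP[s0 s1]; apply: DG; rewrite !ltW.
- apply: derivable_within_continuous => s; rewrite in_itv /= => sI.
  by have [] := DG s sI.
rewrite !fctE /G /g !scale0r !addr0 subr0 => ->.
rewrite in_itv /= in sI.
have := dP _ _ (inb h s hh sI) (inb 0 s h00 sI).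
rewrite scale0r addr0.
have -> : u0 + h *: basis_vec R j + s *: basis_vec R i - (u0 + s *: basis_vec R i) = h *: basis_vec R j.
  by apply/rowP => l; rewrite !mxE; ring.
rewrite basis_line.
set A := fi _ - fi _; move=> AP.
rewrite [X in `|X|](_ : _ = h * (A - h * pd j fi u0)); last by rewrite /A; ring.
rewrite normrM (gtr0_norm h0) mulrC ler_pM2r //; apply: le_trans AP _.
rewrite normrZ (gtr0_norm h0); apply: ler_wpM2l; first exact: ltW.
by rewrite -[leRHS]mulr1; apply: ler_wpM2l; [exact: ltW|exact: norm_basis_le].
Qed.

(** Schwarz's theorem: the second difference is symmetric in the two directions, and divided by h^2
    it approximates both mixed derivatives. *)
Lemma pdC f (f_ : 'I_2 -> 'rV[R]_2 -> R) u0 (r : R) : 0 < r ->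
  (forall u, ball u0 r u -> forall i, [/\ differentiable f u, pd i f u = f_ i u & differentiable (f_ i) u]) ->
  (forall i k, {for u0, continuous (pd k (f_ i))}) ->
  pd 0 (f_ 1) u0 = pd 1 (f_ 0) u0.
Proof.
move=> r0 df cf; apply/eqP; rewrite -subr_eq0 -normr_le0; apply/ler_addgt0Pl => e e0.
rewrite addr0; have e20 : 0 < e / 2 by rewrite divr_gt0.
have [d d0 dP] := second_difference (i := 0) 1 r0 e20 (fun u bu => df u bu 0) (cf 0).
have [d' d'0 d'P] := second_difference (i := 1) 0 r0 e20 (fun u bu => df u bu 1) (cf 1).
have [h h0 hd] : exists2 h : R, 0 < h & h < d /\ h < d'.
  exists (Num.min d d' / 2); first by rewrite divr_gt0 // lt_min d0.
  have : Num.min d d' / 2 < Num.min d d'.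
    by rewrite ltr_pdivrMr // ltr_pMr ?lt_min ?d0 // ltr1n.
  by move=> H; apply/andP; rewrite -lt_min.
have /dP : 0 < h < d by rewrite h0 hd.1.
have /d'P : 0 < h < d' by rewrite h0 hd.2.
rewrite (addrAC u0); set a := pd 0 _ _; set b := pd 1 _ _.
set F1 := f _; set F2 := f _; set F3 := f _; set F4 := f _ => A B.
have : h * h * `|a - b| <= h * h * e.
  rewrite -[X in X * `|_|]ger0_norm ?mulr_ge0 ?(ltW h0) // -normrM.
  rewrite [X in `|X|](_ : _ = (F1 - F3 - (F2 - F4) - h * (h * b)) - (F1 - F2 - (F3 - F4) - h * (h * a))); last by ring.
  apply: le_trans (ler_normB _ _) _. apply: le_trans (lerD B A) _.
  by rewrite [leRHS](_ : _ = e / 2 * h * h + e / 2 * h * h) //; field.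
by rewrite ler_pM2l // mulr_gt0.
Qed.

Lemma pd_near_eq (i : 'I_2) f g u : (\near u, f u = g u) -> pd i f u = pd i g u.
Proof. exact: near_eq_derive. Qed.

Lemma pd_cst (i : 'I_2) (c : R) u : pd i (fun=> c) u = 0.
Proof. exact: derive_cst. Qed.

Lemma pdD (i : 'I_2) f g u : differentiable f u -> differentiable g u ->
  pd i (fun x => f x + g x) u = pd i f u + pd i g u.
Proof. by move=> df dg; apply: deriveD; exact: diff_derivable. Qed.

Lemma pdB (i : 'I_2) f g u : differentiable f u -> differentiable g u ->
  pd i (fun x => f x - g x) u = pd i f u - pd i g u.
Proof. by move=> df dg; apply: deriveB; exact: diff_derivable. Qed.

Lemma pdM (i : 'I_2) f g u : differentiable f u -> differentiable g u ->
  pd i (fun x => f x * g x) u = f u * pd i g u + g u * pd i f u.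
Proof. by move=> df dg; apply: deriveM; exact: diff_derivable. Qed.

Lemma pd0_ball_cst f u0 (r : R) :
  (forall u, ball u0 r u -> differentiable f u /\ forall i, pd i f u = 0) ->
  forall u v, ball u0 r u -> ball u0 r v -> f u = f v.
Proof.
move=> df u v bu bv.
have inb (s : R) : 0 <= s <= 1 -> ball u0 r (v + s *: (u - v)) by exact: ball_convex.
have [s sI E] := line_MVT (fun s sI => (df _ (inb s sI)).1).
by apply: subr0_eq; rewrite E !(df _ (inb s sI)).2 !mulr0 addr0.
Qed.

Lemma C1_on_coord (m : nat) (U : set 'rV[R]_2) (X : 'rV[R]_2 -> 'rV[R]_m.+1) u k :
  open U -> C1_on U X -> U u ->
  [/\ differentiable (fun v => X v 0 k) u,
      forall i, pd i (fun v => X v 0 k) u = partial i X u 0 k &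
      forall i, {for u, continuous (pd i (fun v => X v 0 k))}].
Proof.
move=> oU C1 Uu; have [dX cX] := C1 u Uu.
have E i v : U v -> pd i (fun v => X v 0 k) v = partial i X v 0 k.
  move=> Uv; rewrite /partial derive_mx ?mxE //.
  by apply: diff_derivable; exact: (C1 v Uv).1.
split => [|i|i].
- apply: (@differentiable_comp _ _ _ _ X (fun M : 'rV[R]_m.+1 => M 0 k)) => //.
  exact: differentiable_coord.
- exact: E.
- suff : pd i (fun v => X v 0 k) v @[v --> u] --> pd i (fun v => X v 0 k) u by [].
  rewrite E //; apply: cvg_trans; last first.
    exact: (continuous_comp (cX i) (@coord_continuous R 1 m.+1 0 k (partial i X u))).
  suff H : \near u, partial i X u 0 k = pd i (fun v => X v 0 k) u by exact: near_eq_cvg H.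
  near=> v; rewrite E //; near: v; exact: open_nbhs_nbhs.
Unshelve. all: by end_near. Qed.

End Plane_calculus.

(** * Sums and matrices of size 2 and 3 *)

Lemma sum_I2 (V : nmodType) (f : 'I_2 -> V) : \sum_i f i = f 0 + f 1.
Proof. by rewrite !big_ord_recl big_ord0 addr0; congr (f _ + f _); exact/val_inj. Qed.

Lemma sum_I3 (V : nmodType) (f : 'I_3 -> V) : \sum_i f i = f 0 + (f 1 + f 2).
Proof.
by rewrite !big_ord_recl big_ord0 addr0; congr (f _ + (f _ + f _)); exact/val_inj.
Qed.

Lemma forall_I2 (P : 'I_2 -> Prop) : P 0 -> P 1 -> forall i, P i.
Proof.
by move=> P0 P1 [[|[|//]] p]; [move: P0|move: P1]; congr P; exact/val_inj.
Qed.

Lemma forall_I3 (P : 'I_3 -> Prop) : P 0 -> P 1 -> P 2 -> forall i, P i.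
Proof.
by move=> P0 P1 P2 [[|[|[|//]]] p]; [move: P0|move: P1|move: P2]; congr P; exact/val_inj.
Qed.

Lemma invmx_eq (F : fieldType) (n : nat) (A C : 'M[F]_n) : A *m C = 1%:M -> invmx A = C.
Proof.
by move=> AC1; have [uA _] := mulmx1_unit AC1; rewrite -[LHS]mulmx1 -AC1 mulKmx.
Qed.

Lemma tr_invmx2 (F : fieldType) (A B : 'M[F]_2) (d : F) :
  d = A 0 0 * A 1 1 - A 0 1 * A 1 0 -> d != 0 ->
  \tr (invmx A *m B) * d =
  A 1 1 * B 0 0 + A 0 0 * B 1 1 - A 0 1 * B 1 0 - A 1 0 * B 0 1.
Proof.
move=> dE d0.
pose C : 'M[F]_2 := \matrix_(i, j)
  (d^-1 * nth 0 (nth [::] [:: [:: A 1 1; - A 0 1]; [:: - A 1 0; A 0 0]] i) j).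
rewrite (@invmx_eq _ _ _ C); last first.
  by apply/matrixP; elim/forall_I2; elim/forall_I2; rewrite !mxE sum_I2 !mxE /=;
     move: d0; rewrite dE => d0; field.
by rewrite /mxtrace sum_I2 !mxE !sum_I2 !mxE /=; field.
Qed.

(** * Metric and Levi-Civita connection of Nil_3 in coordinates *)

Section Nil_geometry.
Variable R : realType.

Lemma is_derive_affine (n : nat) (f : 'rV[R]_n -> R) (p v : 'rV[R]_n) (c : R) :
  (forall h : R, f (h *: v + p) = h * c + f p) -> is_derive p v f c.
Proof.
move=> fE.
have lE : (fun h : R => h^-1 *: ((f \o shift p) (h *: v) - f p)) @ 0^' --> c.
  apply: cvg_near_cst; near=> h.
  have h0 : h != 0 by near: h; exact: nbhs_dnbhs_neq.
  by rewrite /= fE addrK /GRing.scale /= mulrA mulVf // mul1r.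
by apply: DeriveDef; [apply/cvg_ex; exists c|exact/cvg_lim].
Unshelve. all: by end_near. Qed.

Variable tau : R.
Implicit Types p v w : 'rV[R]_3.

Lemma is_derive_contact p v w : is_derive p v (fun q => contact_form tau q w)
  (tau * (v 0 1 * w 0 0 - v 0 0 * w 0 1)).
Proof. by apply: is_derive_affine => h; rewrite /contact_form !mxE; ring. Qed.

Lemma derive_gram p (m a b : 'I_3) (e := @basis_vec R 3) :
  'D_(e m) (fun q => nil_gram tau q a b : R^o) p =
  contact_form tau p (e a) * (tau * (e m 0 1 * e b 0 0 - e m 0 0 * e b 0 1)) +
  contact_form tau p (e b) * (tau * (e m 0 1 * e a 0 0 - e m 0 0 * e a 0 1)).
Proof.
have -> : (fun q => nil_gram tau q a b) = 
    cst (e a 0 0 * e b 0 0 + e a 0 1 * e b 0 1) +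
    (fun q => contact_form tau q (e a)) * (fun q => contact_form tau q (e b)).
  by apply/funext => q; rewrite /nil_gram mxE.
have := is_deriveD (is_derive_cst (e a 0 0 * e b 0 0 + e a 0 1 * e b 0 1) p (e m))
  (is_deriveM (is_derive_contact p (e m) (e a)) (is_derive_contact p (e m) (e b))).
by case=> _; rewrite add0r.
Qed.

Lemma basis3E (i j : 'I_3) : basis_vec R i 0 j = (i == j)%:R.
Proof. by rewrite /basis_vec mxE eqxx eq_sym. Qed.

Lemma nil_gramE p (i j : 'I_3) (c := contact_form tau p) :
  nil_gram tau p i j = (i == 0)%:R * (j == 0)%:R + (i == 1)%:R * (j == 1)%:R +
    c (basis_vec R i) * c (basis_vec R j).
Proof. by rewrite /nil_gram mxE /nil_metric !basis3E. Qed.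

Lemma inv_gram p (a := tau * p 0 1) (b := - tau * p 0 0) : invmx (nil_gram tau p) =
  \matrix_(i, j) nth 0 (nth [::] [:: [:: 1; 0; - a]; [:: 0; 1; - b];
    [:: - a; - b; 1 + a ^+ 2 + b ^+ 2]] i) j.
Proof.
apply: invmx_eq; apply/matrixP; elim/forall_I3; elim/forall_I3;
rewrite !mxE sum_I3 !nil_gramE /contact_form !basis3E !mxE /= /a /b; ring.
Qed.

(** The two planar components of the connection are exactly what pairing with a horizontal normal
    reads. *)
Lemma christoffel_contract p v w (k : 'I_3) (om := contact_form tau p) :
  k != 2 ->
  \sum_a \sum_b christoffel tau p k a b * v 0 a * w 0 b =
  if k == 0 then tau * (om v * w 0 1 + om w * v 0 1)
  else - tau * (om v * w 0 0 + om w * v 0 0).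
Proof.
rewrite /christoffel !sum_I3.
rewrite !derive_gram inv_gram /om /contact_form !basis3E !mxE.
by move: k; elim/forall_I3 => //= _; field.
Qed.

End Nil_geometry.

(** * Vertical tangent planes and their mean curvature *)

Section Tangency.
Variables (R : realType) (tau : R).

Lemma contact_lin (p v w : 'rV[R]_3) (a b : R) :
  contact_form tau p (a *: v + b *: w) = a * contact_form tau p v + b * contact_form tau p w.
Proof. by rewrite /contact_form !mxE; ring. Qed.

Lemma contact_eq0 (p v : 'rV[R]_3) :
  v 0 0 = 0 -> v 0 1 = 0 -> contact_form tau p v = 0 -> v = 0.
Proof.
rewrite /contact_form => v0 v1; rewrite v0 v1 !mulr0 subrr mulr0 addr0 => v2.
by apply/rowP; elim/forall_I3; rewrite mxE.
Qed.

Lemma row_free2 (F : fieldType) (n : nat) (A : 'I_2 -> 'rV[F]_n) (a b : F) :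
  row_free (\matrix_i A i) -> a *: A 0 + b *: A 1 = 0 -> a = 0 /\ b = 0.
Proof.
move=> /mulmx_free_eq0 free E.
pose c : 'rV[F]_2 := \row_i (if i == 0 then a else b).
have : c *m (\matrix_i A i) = 0.
  by rewrite mulmx_sum_row sum_I2 !rowK !mxE.
move=> /eqP; rewrite free => /eqP/rowP c0.
by split; [have := c0 0|have := c0 1]; rewrite !mxE.
Qed.

(** Parallel projections force a nonzero vertical combination of the tangent vectors, so n is
    horizontal. The projections are then multiples [h i] of the unit vector (n_1, - n_0), and [h],
    [om] are the coordinates of the tangent vectors in the orthonormal basis formed by its
    horizontal lift and d/dz. *)
Lemma vertical_tangency (p n : 'rV[R]_3) (A : 'I_2 -> 'rV[R]_3)
    (om := fun i => contact_form tau p (A i)) :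
  row_free (\matrix_i A i) ->
  A 0 0 0 * A 1 0 1 - A 0 0 1 * A 1 0 0 = 0 ->
  (forall i, nil_metric tau p (A i) n = 0) -> nil_metric tau p n n = 1 ->
  exists h : 'I_2 -> R, [/\ contact_form tau p n = 0,
    n 0 0 ^+ 2 + n 0 1 ^+ 2 = 1,
    forall i, A i 0 0 = h i * n 0 1 /\ A i 0 1 = - h i * n 0 0 &
    h 0 * om 1 - h 1 * om 0 != 0].
Proof.
move=> free det0 orth unit.
have zero a b : a * A 0 0 0 + b * A 1 0 0 = 0 -> a * A 0 0 1 + b * A 1 0 1 = 0 ->
    a * om 0 + b * om 1 = 0 -> a = 0 /\ b = 0.
  move=> e0 e1 e2; apply: (row_free2 free); apply: (@contact_eq0 p); first by rewrite !mxE.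
    by rewrite !mxE.
  by rewrite contact_lin.
have not0 : ~ ((forall i, A i 0 0 = 0 /\ A i 0 1 = 0) /\ (forall i, om i = 0)).
  move=> [A0 om0]; have [||| /eqP] := zero 1 0; rewrite ?oner_eq0 //.
  - by rewrite !(A0 _).1 !mulr0 addr0.
  - by rewrite !(A0 _).2 !mulr0 addr0.
  - by rewrite !om0 !mulr0 addr0.
have O i : A i 0 0 * n 0 0 + A i 0 1 * n 0 1 + om i * contact_form tau p n = 0.
  exact: orth.
have c0 : contact_form tau p n = 0.
  (* If n had a vertical part c, orthogonality would determine [om i] from the planar part of [A i].
     Planar dependence would then be full dependence, and [det0] would force both vectors to
     vanish. *)
  apply: contrapT => /eqP; set c := contact_form _ _ _ in O * => cN0.
  have comb a b : a * A 0 0 0 + b * A 1 0 0 = 0 -> a * A 0 0 1 + b * A 1 0 1 = 0 -> a = 0 /\ b = 0.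
    move=> e0 e1; apply: zero => //; apply: (mulIf cN0); rewrite mul0r.
    have -> : (a * om 0 + b * om 1) * c = a * (A 0 0 0 * n 0 0 + A 0 0 1 * n 0 1 + om 0 * c)
       + b * (A 1 0 0 * n 0 0 + A 1 0 1 * n 0 1 + om 1 * c)
       - (a * A 0 0 0 + b * A 1 0 0) * n 0 0 - (a * A 0 0 1 + b * A 1 0 1) * n 0 1 by ring.
    by rewrite !O e0 e1; ring.
  have [||a0 /eqP] := comb (A 1 0 0) (- A 0 0 0); first by ring.
    by rewrite -[RHS]oppr0 -det0; ring.
  rewrite oppr_eq0 => /eqP a1.
  have [||b0 /eqP] := comb (A 1 0 1) (- A 0 0 1); first by rewrite -[RHS]det0; ring.
    by ring.
  rewrite oppr_eq0 => /eqP b1.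
  have z : forall i, A i 0 0 = 0 /\ A i 0 1 = 0 by elim/forall_I2.
  apply: not0; split => // i; apply: (mulIf cN0); rewrite mul0r -(O i).
  by rewrite (z i).1 (z i).2; ring.
have n1 : n 0 0 ^+ 2 + n 0 1 ^+ 2 = 1.
  by rewrite -unit /nil_metric c0; ring.
pose h i := A i 0 0 * n 0 1 - A i 0 1 * n 0 0.
have hP i : A i 0 0 = h i * n 0 1 /\ A i 0 1 = - h i * n 0 0.
  have := O i; rewrite c0 mulr0 addr0 /h => e; split.
    rewrite -[LHS]mulr1 -n1 -[LHS]subr0 -(mul0r (n 0 0)) -e; ring.
  rewrite -[LHS]mulr1 -n1 -[LHS]subr0 -(mul0r (n 0 1)) -e; ring.
exists h; split => //; apply/eqP => D.
have [||| h1 /eqP] := zero (h 1) (- h 0).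
- by rewrite (hP 0).1 (hP 1).1; ring.
- by rewrite (hP 0).2 (hP 1).2; ring.
- by rewrite -[RHS]oppr0 -D; ring.
rewrite oppr_eq0 => /eqP h0.
have z : forall i, A i 0 0 = 0 /\ A i 0 1 = 0.
  by elim/forall_I2; rewrite (hP _).1 (hP _).2 ?h0 ?h1; split; ring.
have [||| o1 /eqP] := zero (om 1) (- om 0).
- by rewrite !(z _).1; ring.
- by rewrite !(z _).2; ring.
- by ring.
rewrite oppr_eq0 => /eqP o0.
by apply: not0; split => //; elim/forall_I2.
Qed.

Lemma covariant_deriv_planar (X Y : 'rV[R]_2 -> 'rV[R]_3) (i : 'I_2) (u : 'rV[R]_2) (k : 'I_3)
    (om := contact_form tau (X u)) : k != 2 ->
  covariant_deriv tau X Y i u 0 k = partial i Y u 0 k +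
  if k == 0 then tau * (om (partial i X u) * Y u 0 1 + om (Y u) * partial i X u 0 1)
  else - tau * (om (partial i X u) * Y u 0 0 + om (Y u) * partial i X u 0 0).
Proof.
by move=> k2; rewrite mxE; congr (_ + _); exact: christoffel_contract.
Qed.

Let planar_first (x y hi hj p0 p1 q0 q1 n0 n1 : R) :
  p0 = hi * n1 /\ p1 = - hi * n0 -> q0 = hj * n1 /\ q1 = - hj * n0 ->
  n0 ^+ 2 + n1 ^+ 2 = 1 -> p0 * q0 + p1 * q1 + x * y = hi * hj + x * y.
Proof.
move=> [-> ->] [-> ->] E; congr (_ + _); rewrite -[RHS]mulr1 -E; ring.
Qed.

Let planar_second (s0 s1 hi hj p0 p1 q0 q1 n0 n1 oi oj : R) :
  p0 = hi * n1 /\ p1 = - hi * n0 -> q0 = hj * n1 /\ q1 = - hj * n0 ->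
  n0 ^+ 2 + n1 ^+ 2 = 1 ->
  (s0 + tau * (oi * q1 + oj * p1)) * n0 + (s1 + - tau * (oi * q0 + oj * p0)) * n1 =
  s0 * n0 + s1 * n1 - tau * (oi * hj + oj * hi).
Proof.
move=> [-> ->] [-> ->] E; rewrite -[X in _ - tau * X]mulr1 -E; ring.
Qed.

Lemma cross_neq0 (F : fieldType) (x y z t : F) :
  x * z - y * t != 0 -> (x != 0) || (y != 0).
Proof.
by apply: contraNT; rewrite negb_or !negbK => /andP[/eqP-> /eqP->]; rewrite !mul0r subrr.
Qed.

(** A symmetric form whose rows are all proportional to h is a multiple of the square of h. *)
Lemma rank_one (F : fieldType) (h : 'I_2 -> F) (b : 'I_2 -> 'I_2 -> F) :
  (h 0 != 0) || (h 1 != 0) ->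
  (forall k, h 0 * b k 1 = h 1 * b k 0) -> b 0 1 = b 1 0 ->
  exists be, forall i j, b i j = be * h i * h j.
Proof.
move=> h01 bP bC.
have [h0|h0] := eqVneq (h 0) 0.
  have h1 : h 1 != 0 by move: h01; rewrite h0 eqxx.
  have bz k : b k 0 = 0 by apply: (mulfI h1); rewrite -bP h0 mulr0 mul0r.
  exists (b 1 1 / h 1 ^+ 2); elim/forall_I2; elim/forall_I2.
  - by rewrite h0 mulr0 bz.
  - by rewrite bC h0 mulr0 mul0r bz.
  - by rewrite h0 mulr0 bz.
  - by field.
have b1 k : b k 1 = h 1 * b k 0 / h 0 by rewrite -bP; field.
exists (b 0 0 / h 0 ^+ 2); elim/forall_I2; elim/forall_I2.
- by field.
- by rewrite b1; field.
- by rewrite -bC b1; field.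
- by rewrite b1 -bC b1; field.
Qed.

(** The coframe ([h], [om]) is orthonormal for the induced metric, and in it the second form is be h
    h - tau (h om + om h). The terms in tau are off-diagonal, so the trace is [be] and 2 H = be. *)
Lemma mean_curvature_vertical (X : 'rV[R]_2 -> 'rV[R]_3) (n : 'rV[R]_3) (u : 'rV[R]_2)
    (h : 'I_2 -> R) (om := fun i => contact_form tau (X u) (partial i X u))
    (s := fun i j => partial i (partial j X) u)
    (b := fun i j => s i j 0 0 * n 0 0 + s i j 0 1 * n 0 1) :
  contact_form tau (X u) n = 0 -> n 0 0 ^+ 2 + n 0 1 ^+ 2 = 1 ->
  (forall i, partial i X u 0 0 = h i * n 0 1 /\ partial i X u 0 1 = - h i * n 0 0) ->
  h 0 * om 1 - h 1 * om 0 != 0 ->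
  (forall k, h 0 * b k 1 = h 1 * b k 0) -> b 0 1 = b 1 0 ->
  forall i j, b i j = 2 * mean_curvature tau X n u * h i * h j.
Proof.
move=> c0 n1 hP D bP bC.
have h01 : (h 0 != 0) || (h 1 != 0).
  exact: cross_neq0 D.
have [be beP] := rank_one h01 bP bC.
have II i j : second_form tau X n u i j = be * h i * h j - tau * (om i * h j + om j * h i).
  have E0 : covariant_deriv tau X (partial j X) i u 0 0 =
      s i j 0 0 + tau * (om i * partial j X u 0 1 + om j * partial i X u 0 1).
    exact: (@covariant_deriv_planar X (partial j X) i u 0 isT).
  have E1 : covariant_deriv tau X (partial j X) i u 0 1 =
      s i j 0 1 + - tau * (om i * partial j X u 0 0 + om j * partial i X u 0 0).
    exact: (@covariant_deriv_planar X (partial j X) i u 1 isT).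
  rewrite mxE /nil_metric c0 mulr0 addr0 E0 E1 -beP /b.
  exact: (planar_second _ _ _ _ (hP i) (hP j) n1).
have I1 i j : first_form tau X u i j = h i * h j + om i * om j.
  by rewrite mxE; exact: (planar_first _ _ (hP i) (hP j) n1).
suff -> : mean_curvature tau X n u = 2^-1 * be by move=> i j; rewrite beP; field.
rewrite /mean_curvature; congr (_ * _).
move: (first_form tau X u) (second_form tau X n u) I1 II => A B I1 II; clearbody om.
(* The determinant of the first form is the square of the determinant of the coframe. *)
have D2 : (h 0 * om 1 - h 1 * om 0) ^+ 2 != 0 by rewrite expf_neq0.
have dE : (h 0 * om 1 - h 1 * om 0) ^+ 2 = A 0 0 * A 1 1 - A 0 1 * A 1 0.
  by rewrite !I1; ring.
by apply: (mulIf D2); rewrite (tr_invmx2 B dE D2) !I1 !II; ring.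
Qed.

End Tangency.

(** * The normal moves as - k times the projection *)

Section Rigidity.
Variable R : realType.

Lemma differentiable_sqrt (f : 'rV[R]_2 -> R) u :
  differentiable f u -> 0 < f u -> differentiable (fun x => Num.sqrt (f x)) u.
Proof.
move=> df f0; apply: (@differentiable_comp _ _ _ _ f (@Num.sqrt R)) => //.
by apply/derivable1_diffP; have [] := is_derive1_sqrt f0.
Qed.

(** A derivative a of the unit vector m is c times m turned by a quarter. The rate c is read off the
    derivative (q0, q1) of H (m1, - m0): paired with m, the term containing the derivative q of H
    cancels. *)
Lemma rotation_rate (m0 m1 a0 a1 c H q q0 q1 : R) :
  m0 ^+ 2 + m1 ^+ 2 = 1 -> m0 * a0 + m0 * a0 + (m1 * a1 + m1 * a1) = 0 -> H != 0 ->
  q0 = H * a1 + m1 * q -> q1 = - (H * a0 + m0 * q) ->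
  q0 * m0 + q1 * m1 = c * H -> a0 = - c * m1 /\ a1 = c * m0.
Proof.
move=> m1E orth H0 -> -> E.
have o : m0 * a0 + m1 * a1 = 0 by lra.
have cE : c = m0 * a1 - m1 * a0.
  by apply: (mulIf H0); rewrite -E; ring.
rewrite cE; split; rewrite -[LHS]mulr1 -m1E.
  by rewrite -[LHS]subr0 -(mulr0 m0) -o; ring.
by rewrite -[LHS]subr0 -(mulr0 m1) -o; ring.
Qed.

(** No differentiability of n is assumed. It is recovered from the nonvanishing partial derivative p
    of the projection: n is p turned by a quarter and normalized, with the sign [sg] fixed on the
    ball. *)
Lemma normal_translate (x0 x1 p0 p1 n0 n1 : 'rV[R]_2 -> R) (h : 'I_2 -> 'rV[R]_2 -> R)
    (j : 'I_2) (k sg : R) (u0 : 'rV[R]_2) (r : R) : sg ^+ 2 = 1 ->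
  (forall u, ball u0 r u -> [/\ differentiable x0 u, differentiable x1 u,
     differentiable p0 u & differentiable p1 u]) ->
  (forall u, ball u0 r u -> [/\ n0 u ^+ 2 + n1 u ^+ 2 = 1,
     p0 u = h j u * n1 u, p1 u = - h j u * n0 u & 0 < sg * h j u]) ->
  (forall u i, ball u0 r u -> [/\ pd i x0 u = h i u * n1 u, pd i x1 u = - h i u * n0 u &
     pd i p0 u * n0 u + pd i p1 u * n1 u = k * h i u * h j u]) ->
  forall u v, ball u0 r u -> ball u0 r v ->
    n0 u + k * x0 u = n0 v + k * x0 v /\ n1 u + k * x1 u = n1 v + k * x1 v.
Proof.
move=> sg1 df nP pP.
(* [H] and [m0], [m1] agree with [h j] and [n0], [n1] on the ball, but their formulas are visibly
   differentiable. *)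
pose H u := sg * Num.sqrt (p0 u * p0 u + p1 u * p1 u).
pose m0 u := - (p1 u) * (H u)^-1; pose m1 u := p0 u * (H u)^-1.
have HE u : ball u0 r u -> H u = h j u /\ h j u != 0.
  move=> bu; have [n1E pE qE sh] := nP u bu.
  have hsg : h j u = sg * (sg * h j u) by rewrite mulrA -expr2 sg1 mul1r.
  split; last by apply: contraTneq sh => ->; rewrite mulr0 ltxx.
  rewrite /H pE qE; have -> : h j u * n1 u * (h j u * n1 u) + - h j u * n0 u * (- h j u * n0 u)
     = (sg * h j u) ^+ 2 by rewrite exprMn sg1 mul1r -[RHS]mulr1 -n1E; ring.
  by rewrite sqrtr_sqr gtr0_norm.
have mE u : ball u0 r u -> m0 u = n0 u /\ m1 u = n1 u.
  move=> bu; have [He h0] := HE u bu; have [_ pE qE _] := nP u bu.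
  by rewrite /m0 /m1 He pE qE; split; field.
have dH u : ball u0 r u -> differentiable H u.
  move=> bu; have [_ _ d0 d1] := df u bu; apply: differentiableM; first exact: differentiable_cst.
  apply: differentiable_sqrt; first by apply: differentiableD; exact: differentiableM.
  have [He h0] := HE u bu; move: h0; rewrite -He /H mulf_eq0 negb_or sqrtr_eq0 -ltNge.
  by case/andP.
have dV u : ball u0 r u -> differentiable (fun x => (H x)^-1) u.
  move=> bu; apply: differentiableV; first exact: dH.
  by have [-> ] := HE u bu.
have dm u : ball u0 r u -> differentiable m0 u /\ differentiable m1 u.
  move=> bu; have [_ _ d0 d1] := df u bu; split; apply: differentiableM; try exact: dV; try exact: d0.
  exact: differentiableN.
have near_ball u (P : 'rV[R]_2 -> Prop) : ball u0 r u -> (forall v, ball u0 r v -> P v) ->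
    \near u, P u.
  move=> bu HP; near=> v; apply: HP; near: v.
  apply: (@open_nbhs_nbhs _ u (ball u0 r)); split => //; exact: ball_open.
have key u i : ball u0 r u -> pd i m0 u = - k * pd i x0 u /\ pd i m1 u = - k * pd i x1 u.
  move=> bu; have [d0 d1] := dm u bu; have dHu := dH u bu.
  have [m0E m1E] := mE u bu; have [He h0] := HE u bu.
  have [q0 q1 bE] := pP u i bu.
  have e0 : pd i p0 u = H u * pd i m1 u + m1 u * pd i H u.
    rewrite -pdM //; apply: pd_near_eq; apply: near_ball => // v bv.
    have [-> _] := HE v bv; have [_ ->] := mE v bv; by have [_ -> _ _] := nP v bv.
  have e1 : pd i p1 u = - (H u * pd i m0 u + m0 u * pd i H u).
    rewrite -pdM // -[RHS]sub0r -(pd_cst i 0 u) -pdB; last 2 first.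
      exact: differentiable_cst.
      exact: differentiableM.
    apply: pd_near_eq; apply: near_ball => // v bv.
    have [-> _] := HE v bv; have [-> _] := mE v bv; have [_ _ -> _] := nP v bv.
    by rewrite sub0r mulNr.
  have e2 : m0 u * pd i m0 u + m0 u * pd i m0 u + (m1 u * pd i m1 u + m1 u * pd i m1 u) = 0.
    rewrite -!pdM // -pdD; try exact: differentiableM.
    rewrite -(pd_cst i 1 u); apply: pd_near_eq; apply: near_ball => // v bv.
    by have [-> ->] := mE v bv; have [<- _ _ _] := nP v bv; rewrite !expr2.
  have n1E : m0 u ^+ 2 + m1 u ^+ 2 = 1 by rewrite m0E m1E; have [] := nP u bu.
  have H0 : H u != 0 by rewrite He.
  have bE' : pd i p0 u * m0 u + pd i p1 u * m1 u = k * h i u * H u.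
    by rewrite m0E m1E He.
  have [-> ->] := rotation_rate n1E e2 H0 e0 e1 bE'.
  by rewrite q0 q1 m0E m1E; split; ring.
have fin (m x : 'rV[R]_2 -> R) : (forall u, ball u0 r u -> differentiable m u /\ differentiable x u) ->
    (forall u i, ball u0 r u -> pd i m u = - k * pd i x u) ->
    forall u v, ball u0 r u -> ball u0 r v -> m u + k * x u = m v + k * x v.
  move=> dd pp; apply: (@pd0_ball_cst _ (fun u => m u + k * x u)) => u bu; have [dm' dx'] := dd u bu.
  have dk : differentiable (fun x => k : R) u by exact: differentiable_cst.
  split; first by apply: differentiableD => //; exact: differentiableM.
  move=> i; rewrite pdD //; last exact: differentiableM.
  by rewrite pdM // pd_cst pp //; ring.
move=> u v bu bv; have [<- <-] := mE u bu; have [<- <-] := mE v bv.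
split; apply: fin => //.
- by move=> w bw; have [? ? ? ?] := df w bw; have [? ?] := dm w bw.
- by move=> w i bw; have [] := key w i bw.
- by move=> w bw; have [? ? ? ?] := df w bw; have [? ?] := dm w bw.
- by move=> w i bw; have [] := key w i bw.
Unshelve. all: by end_near. Qed.

End Rigidity.

(** * The surface read in one chart *)

Lemma cross_deriv (R : realType) (p00 p01 p10 p11 : 'rV[R]_2 -> R) (k : 'I_2) u :
  differentiable p00 u -> differentiable p01 u -> differentiable p10 u -> differentiable p11 u ->
  (\near u, p00 u * p11 u - p01 u * p10 u = 0) ->
  p00 u * pd k p11 u + p11 u * pd k p00 u - (p01 u * pd k p10 u + p10 u * pd k p01 u) = 0.
Proof.
move=> d00 d01 d10 d11 D0.
have M00 := differentiableM d00 d11; have M11 := differentiableM d01 d10.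
by rewrite -(pdM k d00 d11) -(pdM k d01 d10) -(pdB k M00 M11) -(pd_cst k 0 u); exact: pd_near_eq.
Qed.

Lemma cross_algebra (R : realType) (h0 h1 n0 n1 a00 a01 a10 a11 q00 q01 q10 q11 s00 s01 s10 s11 : R) :
  a00 = h0 * n1 -> a01 = - h0 * n0 -> a10 = h1 * n1 -> a11 = - h1 * n0 ->
  q00 = s00 -> q01 = s01 -> q10 = s10 -> q11 = s11 ->
  a00 * q11 + a11 * q00 - (a01 * q10 + a10 * q01) = 0 ->
  h0 * (s10 * n0 + s11 * n1) = h1 * (s00 * n0 + s01 * n1).
Proof.
by move=> -> -> -> -> -> -> -> -> E; apply: subr0_eq; rewrite -[RHS]E; ring.
Qed.

Section Chart.
Variables (R : realType) (tau lambda : R) (U : set 'rV[R]_2).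
Variables (X n : 'rV[R]_2 -> 'rV[R]_3).
Hypotheses (oU : open U) (C2 : C2_on U X) (immX : immersion_on U X).
Hypothesis det0 : forall u, U u ->
  partial 0 X u 0 0 * partial 1 X u 0 1 - partial 0 X u 0 1 * partial 1 X u 0 0 = 0.
Hypothesis n_unit : forall u, U u -> nil_metric tau (X u) (n u) (n u) = 1.
Hypothesis n_orth : forall u i, U u -> nil_metric tau (X u) (partial i X u) (n u) = 0.

Lemma chart_vertical u : U u -> exists h : 'I_2 -> R, [/\ contact_form tau (X u) (n u) = 0,
    n u 0 0 ^+ 2 + n u 0 1 ^+ 2 = 1,
    forall i, partial i X u 0 0 = h i * n u 0 1 /\ partial i X u 0 1 = - h i * n u 0 0 &
    h 0 * contact_form tau (X u) (partial 1 X u) - h 1 * contact_form tau (X u) (partial 0 X u) != 0].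
Proof.
move=> Uu; apply: (@vertical_tangency _ _ _ _ (fun i => partial i X u)).
- exact: immX.
- exact: det0.
- by move=> i; exact: n_orth.
- exact: n_unit.
Qed.

Let pX (i : 'I_2) (k : 'I_3) (u : 'rV[R]_2) := partial i X u 0 k.

Lemma open_ball_sub u : U u -> exists2 r : R, 0 < r & ball u r `<=` U.
Proof.
move=> Uu; have /nbhs_ballP[r r0 rU] : nbhs u U by exact: open_nbhs_nbhs.
by exists r.
Qed.

Lemma chart_first u k : U u -> differentiable (fun v => X v 0 k) u /\
  forall i, pd i (fun v => X v 0 k) u = pX i k u.
Proof. by move=> Uu; have [] := C1_on_coord k oU C2.1 Uu. Qed.

Lemma chart_second u i k : U u -> [/\ differentiable (pX i k) u,
  forall j, pd j (pX i k) u = partial j (partial i X) u 0 k &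
  forall j, {for u, continuous (pd j (pX i k))}].
Proof. by move=> Uu; exact: (C1_on_coord k oU (C2.2 i) Uu). Qed.

Lemma chart_symmetric u k : U u ->
  partial 0 (partial 1 X) u 0 k = partial 1 (partial 0 X) u 0 k.
Proof.
move=> Uu; have [r r0 rU] := open_ball_sub Uu.
have [_ p1 _] := chart_second 1 k Uu; have [_ p0 _] := chart_second 0 k Uu.
apply: (etrans (esym (p1 0))); apply: (etrans _ (p0 1)).
apply: (@pdC _ (fun v => X v 0 k) (fun i => pX i k) u r) => //.
  move=> v /rU Uv i; have [d p] := chart_first k Uv.
  by split => //; have [] := chart_second i k Uv.
by move=> i j; have [] := chart_second i k Uu.
Qed.

Hypothesis n_cont : forall u, U u -> {for u, continuous n}.
Hypothesis n_mean : forall u, U u ->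
  mean_curvature tau X (n u) u = nil_metric tau (X u) (n u) (basis_vec R 2) + lambda.

(** [chart_vertical] gives the factors h pointwise only; this closed formula makes them functions of
    u whose continuity can be used. *)
Let h i u := pX i 0 u * n u 0 1 - pX i 1 u * n u 0 0.

Lemma chart_h u i : U u ->
  pX i 0 u = h i u * n u 0 1 /\ pX i 1 u = - h i u * n u 0 0.
Proof.
move=> Uu; have [g [_ n1 gP _]] := chart_vertical Uu.
rewrite /h /pX (gP i).1 (gP i).2; split.
  by rewrite -[LHS]mulr1 -n1; ring.
by rewrite -[LHS]mulr1 -n1; ring.
Qed.

Lemma chart_h_neq0 u : U u -> exists i, h i u != 0.
Proof.
move=> Uu; have [g [_ n1 gP gN]] := chart_vertical Uu.
have hg i : h i u = g i.
  by rewrite /h /pX (gP i).1 (gP i).2 -[RHS]mulr1 -n1; ring.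
by have /orP[g0|g0] := cross_neq0 gN; [exists 0|exists 1]; rewrite hg.
Qed.

(** Derivative of the identity [det0], which holds on the whole chart: this is the proportionality
    of rows that [rank_one] asks for. *)
Lemma chart_det_deriv u k : U u ->
  h 0 u * (partial k (partial 1 X) u 0 0 * n u 0 0 + partial k (partial 1 X) u 0 1 * n u 0 1) =
  h 1 u * (partial k (partial 0 X) u 0 0 * n u 0 0 + partial k (partial 0 X) u 0 1 * n u 0 1).
Proof.
move=> Uu.
have D0 : \near u, pX 0 0 u * pX 1 1 u - pX 0 1 u * pX 1 0 u = 0.
  near=> v; apply: det0; near: v; exact: open_nbhs_nbhs.
have [d00 p00 _] := chart_second 0 0 Uu; have [d01 p01 _] := chart_second 0 1 Uu.
have [d10 p10 _] := chart_second 1 0 Uu; have [d11 p11 _] := chart_second 1 1 Uu.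
have [e0 e1] := chart_h 0 Uu; have [f0 f1] := chart_h 1 Uu.
exact: (cross_algebra e0 e1 f0 f1 (p00 k) (p01 k) (p10 k) (p11 k) (cross_deriv k d00 d01 d10 d11 D0)).
Unshelve. all: by end_near. Qed.

Lemma chart_second_planar u i j : U u ->
  partial i (partial j X) u 0 0 * n u 0 0 + partial i (partial j X) u 0 1 * n u 0 1
  = 2 * lambda * h i u * h j u.
Proof.
move=> Uu; have [g [c0 n1 gP gN]] := chart_vertical Uu.
have hg l : h l u = g l.
  by rewrite /h /pX (gP l).1 (gP l).2 -[RHS]mulr1 -n1; ring.
have lamE : mean_curvature tau X (n u) u = lambda.
  rewrite n_mean // /nil_metric c0 mul0r addr0 !basis3E.
  by rewrite !mulr0 !add0r.
rewrite -lamE !hg.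
apply: (mean_curvature_vertical c0 n1 gP gN).
  by move=> l; rewrite -!hg; exact: chart_det_deriv.
exact: (f_equal2 (fun a b => a * n u 0 0 + b * n u 0 1) (chart_symmetric 0 Uu) (chart_symmetric 1 Uu)).
Qed.

Lemma chart_gauss_translate u0 : U u0 -> exists r : R, [/\ 0 < r, ball u0 r `<=` U &
  forall u, ball u0 r u -> n u 0 0 + 2 * lambda * X u 0 0 = n u0 0 0 + 2 * lambda * X u0 0 0 /\
    n u 0 1 + 2 * lambda * X u 0 1 = n u0 0 1 + 2 * lambda * X u0 0 1].
Proof.
move=> Uu0; have [j hj] := chart_h_neq0 Uu0.
(* By continuity [h j] keeps the sign it has at u0 on a small ball. *)
pose sg := Num.sg (h j u0).
have sg1 : sg ^+ 2 = 1 by rewrite /sg sqr_sg hj.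
have sh : 0 < sg * h j u0 by rewrite /sg -normrEsg normr_gt0.
have nc k : {for u0, continuous (fun v => n v 0 k)}.
  exact: (continuous_comp (n_cont Uu0) (@coord_continuous R 1 3 0 k (n u0))).
have pc k : {for u0, continuous (pX j k)}.
  by have [d _ _] := chart_second j k Uu0; exact: differentiable_continuous.
have hc : sg * h j v @[v --> u0] --> sg * h j u0.
  exact: (cvgM (cvg_cst sg) (cvgB (cvgM (pc 0) (nc 1)) (cvgM (pc 1) (nc 0)))).
have /nbhs_ballP[r r0 rP] : \near u0, U u0 /\ 0 < sg * h j u0.
  near=> v; split; near: v; first exact: open_nbhs_nbhs.
  exact: (cvgr_gt _ hc _ sh).
have r0' : ball u0 r u0 by exact: ballxx.
exists r; split => // [v /rP[]//|u bu].
apply: (@normal_translate R (fun v => X v 0 0) (fun v => X v 0 1) (pX j 0) (pX j 1)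
  (fun v => n v 0 0) (fun v => n v 0 1) h j (2 * lambda) sg u0 r) => //.
- move=> v /rP[Uv _]; have [a0 _] := chart_first 0 Uv; have [a1 _] := chart_first 1 Uv.
  have [b0 _ _] := chart_second j 0 Uv; have [b1 _ _] := chart_second j 1 Uv.
  by split; [exact: a0|exact: a1|exact: b0|exact: b1].
- move=> v /rP[Uv hv]; have [e0 e1] := chart_h j Uv; split => //.
  by have [? []] := chart_vertical Uv.
- move=> v i /rP[Uv _]; have [e0 e1] := chart_h i Uv.
  have [_ f0] := chart_first 0 Uv; have [_ f1] := chart_first 1 Uv.
  have [_ g0 _] := chart_second j 0 Uv; have [_ g1 _] := chart_second j 1 Uv.
  by rewrite f0 f1 g0 g1 chart_second_planar.
Unshelve. all: by end_near. Qed.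

(** The differential of Q is 2 (k g - W).dg = - 2 n.dg, and n is orthogonal to dg. *)
Lemma chart_quadric (W0 W1 : R) : let k := 2 * lambda in
  (forall u, U u -> n u 0 0 + k * X u 0 0 = W0 /\ n u 0 1 + k * X u 0 1 = W1) ->
  let Q u := k * (X u 0 0 * X u 0 0 + X u 0 1 * X u 0 1) - 2 * (W0 * X u 0 0 + W1 * X u 0 1) in
  forall u0 (r : R), ball u0 r `<=` U -> forall u v, ball u0 r u -> ball u0 r v -> Q u = Q v.
Proof.
move=> k WE Q u0 r rU; apply: pd0_ball_cst => u /rU Uu.
have [d0 f0] := chart_first 0 Uu; have [d1 f1] := chart_first 1 Uu.
have dc (c : R) : differentiable (fun _ : 'rV[R]_2 => c) u by exact: differentiable_cst.
have M00 := differentiableM d0 d0; have M11 := differentiableM d1 d1.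
have Mk := differentiableM (dc k) (differentiableD M00 M11).
have W0d := differentiableM (dc W0) d0; have W1d := differentiableM (dc W1) d1.
have M2 := differentiableM (dc 2) (differentiableD W0d W1d).
split; first exact: (differentiableB Mk M2).
move=> i; rewrite /Q (pdB i Mk M2) (pdM i (dc k) (differentiableD M00 M11)).
rewrite (pdM i (dc 2) (differentiableD W0d W1d)) (pdD i M00 M11) (pdD i W0d W1d).
rewrite (pdM i d0 d0) (pdM i d1 d1) (pdM i (dc W0) d0) (pdM i (dc W1) d1) !pd_cst f0 f1.
have [e0 e1] := chart_h i Uu; rewrite e0 e1.
have [<- <-] := WE u Uu; rewrite !fctE; ring.
Qed.

End Chart.

(** * A counting argument, Baire category and countable covers *)

Section Pigeonhole.
Variable R : realType.

Let cell (rho : R) (m : nat) (w0 w : 'rV[R]_2) : {ffun 'I_2 -> 'I_m.+1} :=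
  [ffun i => inord (Num.truncn (m%:R * (w 0 i - w0 0 i + rho) / (2 * rho)))].

Let cell_close (rho : R) (m : nat) (w0 w w' : 'rV[R]_2) : 0 < rho -> (0 < m)%N ->
  `|w - w0| <= rho -> `|w' - w0| <= rho -> cell rho m w0 w = cell rho m w0 w' ->
  `|w - w'| <= 2 * rho / m%:R.
Proof.
move=> rho0 m0 wr wr' /ffunP E.
have mR : (0 : R) < m%:R by rewrite ltr0n.
have r2 : 0 < 2 * rho by rewrite mulr_gt0.
apply: norm_le_coord => [|i]; first by rewrite divr_ge0 ?(ltW r2) ?(ltW mR).
move: (E i); rewrite !ffunE => /(congr1 val) /=.
pose t (v : 'rV[R]_2) := m%:R * (v 0 i - w0 0 i + rho) / (2 * rho).
have tP v : `|v - w0| <= rho -> 0 <= t v /\ (Num.truncn (t v) < m.+1)%N.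
  move=> vr; have := le_trans (coord_le_norm (v - w0) i) vr.
  rewrite !mxE ler_norml => /andP[h1 h2].
  have t0 : 0 <= t v by rewrite /t divr_ge0 ?mulr_ge0 //; [lra|exact: ltW].
  split => //; rewrite ltnS -(ler_nat R); have /andP[+ _] := truncn_itv t0; move/le_trans; apply.
  by rewrite /t ler_pdivrMr // ler_pM2l //; lra.
have [a0 a1] := tP w wr; have [b0 b1] := tP w' wr'.
rewrite -!/(t _) !inordK // => e.
have /andP[h1 h2] := truncn_itv a0; have /andP[h3 h4] := truncn_itv b0.
rewrite e in h1 h2; rewrite -natr1 in h2; rewrite -natr1 in h4.
have d : `|t w - t w'| <= 1 by rewrite ler_norml; apply/andP; split; lra.
have -> : (w - w') 0 i = (t w - t w') * (2 * rho / m%:R).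
  by rewrite /t !mxE; field; rewrite ?gt_eqF.
have q0 : 0 <= 2 * rho / m%:R by apply: divr_ge0; exact: ltW.
by rewrite normrM (ger0_norm q0) -[leRHS]mul1r; exact: ler_wpM2r.
Qed.

(* A grid of n^3 points of the cube has well-separated images, while the       *)
(* square splits into (A n + 1)^2 < n^3 cells with images of small diameter.   *)
Lemma no_cube_in_square (Psi : 'rV[R]_3 -> 'rV[R]_3) (Y : 'rV[R]_2 -> 'rV[R]_3)
    (y0 : 'rV[R]_3) (w0 : 'rV[R]_2) (delta c rho L : R) :
  0 < delta -> 0 < c -> 0 < rho -> 0 <= L ->
  (forall y y', ball y0 delta y -> ball y0 delta y' -> c * `|y - y'| <= `|Psi y - Psi y'|) ->
  (forall w w', `|w - w0| <= rho -> `|w' - w0| <= rho -> `|Y w - Y w'| <= L * `|w - w'|) ->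
  ~ (forall y, ball y0 delta y -> exists2 w, `|w - w0| <= rho & Y w = Psi y).
Proof.
move=> d0 c0 r0 L0 Pexp Ylip Hcov.
(* With spacing eta = delta / (2 n) and m = A n subdivisions, two grid points sharing a cell would
   give c eta <= 2 L rho / (A n), that is c delta A <= 4 L rho. The choice of [A] forbids this. *)
pose A := (Num.truncn (4 * L * rho / (c * delta))).+1.
have AP : 4 * L * rho < c * delta * A%:R.
  have q0 : 0 <= 4 * L * rho / (c * delta) by rewrite divr_ge0 ?mulr_ge0 ?(ltW r0) ?(ltW c0) ?(ltW d0).
  have /andP[_] := truncn_itv q0; rewrite -/A ltr_pdivrMr ?mulr_gt0 //.
  by rewrite (mulrC A%:R).
(* There are at most (m + 1)^2 <= (2 A n)^2 = 4 A^2 n^2 cells, fewer than n^3 because n > 4 A^2. *)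
pose n := (4 * A ^ 2).+1; pose m := (A * n)%N.
have n0 : (0 : R) < n%:R by rewrite ltr0n.
have m0 : (0 < m)%N by rewrite muln_gt0.
have mR : (0 : R) < m%:R by rewrite ltr0n.
pose eta := delta / (2 * n%:R).
have eta0 : 0 < eta by rewrite divr_gt0 // mulr_gt0.
pose y (g : {ffun 'I_3 -> 'I_n}) := y0 + \row_i ((g i)%:R * eta) : 'rV[R]_3.
have yb g : ball y0 delta (y g).
  rewrite -ball_normE /= /y opprD addrA subrr add0r normrN.
  apply: (@le_lt_trans _ _ (delta / 2)); last by lra.
  apply: norm_le_coord => [|i]; first by lra.
  have ge0 : 0 <= (g i)%:R * eta by apply: mulr_ge0 => //; exact: ltW.
  rewrite mxE (ger0_norm ge0).
  have -> : delta / 2 = n%:R * eta by rewrite /eta; field; rewrite gt_eqF.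
  by rewrite (ler_pM2r eta0) ler_nat ltnW.
have Hw g : exists w, `|w - w0| <= rho /\ Y w = Psi (y g).
  by have [w] := Hcov _ (yb g); exists w.
have [W WP] := choice Hw.
have inj : injective (fun g => cell rho m w0 (W g)).
  move=> g g' E; apply/eqP/negPn/negP => gg'.
  have close := cell_close r0 m0 (WP g).1 (WP g').1 E.
  have [i gi] : exists i, g i != g' i.
    apply/existsP; rewrite -negb_forall; apply: contra gg' => /forallP H.
    by apply/eqP/ffunP => i; apply/eqP.
  have far : eta <= `|y g - y g'|.
    apply: le_trans (coord_le_norm _ i); rewrite !mxE.
    have -> : y0 0 i + (g i)%:R * eta - (y0 0 i + (g' i)%:R * eta) = ((g i)%:R - (g' i)%:R) * eta by ring.
    rewrite normrM (gtr0_norm eta0) ler_peMl ?(ltW eta0) //.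
    move: gi; rewrite neq_ltn => /orP[] h.
      by rewrite distrC ger0_norm ?subr_ge0 ?ler_nat ?(ltnW h) // -natrB ?(ltnW h) // ler1n subn_gt0.
    by rewrite ger0_norm ?subr_ge0 ?ler_nat ?(ltnW h) // -natrB ?(ltnW h) // ler1n subn_gt0.
  have E1 := Pexp _ _ (yb g) (yb g').
  have E2 := Ylip _ _ (WP g).1 (WP g').1.
  rewrite (WP g).2 (WP g').2 in E2.
  have : c * eta <= L * (2 * rho / m%:R).
    apply: le_trans (le_trans E1 (le_trans E2 _)).
      by rewrite ler_pM2l.
    by rewrite ler_wpM2l.
  rewrite leNgt => /negP; apply.
  have AR : (0 : R) < A%:R by rewrite ltr0n.
  rewrite /m natrM /eta.
  rewrite [ltLHS](_ : _ = (4 * L * rho) / (2 * A%:R * n%:R)); last by field; rewrite !gt_eqF.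
  rewrite [ltRHS](_ : _ = (c * delta * A%:R) / (2 * A%:R * n%:R)); last by field; rewrite !gt_eqF.
  by rewrite ltr_pM2r // invr_gt0 !mulr_gt0.
have := leq_card _ inj; rewrite !card_ffun !card_ord leqNgt => /negP; apply.
have : (m.+1 <= 2 * A * n)%N.
  by rewrite mul2n -addnn mulnDl -/m -addn1 leq_add2l.
move=> /(leq_trans _); move=> /(_ _ (leqnn _)) H.
apply: (@leq_ltn_trans ((2 * A * n) ^ 2)); first by rewrite leq_exp2r.
by rewrite !expnMn (expnS n 2) ltn_pmul2r ?expn_gt0.
Qed.

Lemma Baire_cover (Psi : 'rV[R]_3 -> 'rV[R]_3) (y0 : 'rV[R]_3) (r : R)
    (A : nat -> set 'rV[R]_3) : 0 < r ->
  (forall y, ball y0 r y -> {for y, continuous Psi}) -> (forall i, closed (A i)) ->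
  (forall y, ball y0 r y -> exists i, A i (Psi y)) ->
  exists i y1 d, [/\ 0 < d, ball y1 d `<=` ball y0 r & forall y, ball y1 d y -> A i (Psi y)].
Proof.
move=> r0 cP cA covP.
pose V i := ball y0 r `&` Psi @^-1` (~` A i).
(* Adding the exterior of the ball lets density be stated in the whole complete space. A point of
   the ball lying in every [O i] would have its image outside every [A i]. *)
pose O i := V i `|` ~` closure (ball y0 r).
have oO i : open (O i).
  apply: openU; last by apply: closed_openC; exact: closed_closure.
  rewrite openE => y [by0 yA]; apply: filterI.
    by apply: open_nbhs_nbhs; split => //; exact: ball_open.
  by apply: (cP y by0); apply: open_nbhs_nbhs; split => //; exact: closed_openC.
have [dO|] := pselect (forall i, dense (O i)).
  have [//||y [by0 yO]] := @Baire R (HB.pack_for (completeNormedModType R) 'rV[R]_3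
    (Complete.on 'rV[R]_3) (NormedModule.on 'rV[R]_3)) O (fun i => conj (oO i) (dO i)) (ball y0 r).
  - by exists y0; exact: ballxx.
  - exact: ball_open.
  - have [i Ai] := covP y by0; have [[_ /(_ Ai)//]|] := yO i I.
    by move=> h; exfalso; apply: h; exact: subset_closure.
move=> /existsNP[i ndO]; exists i.
have [D [D0 oD DO]] : exists D, [/\ D !=set0, open D & D `&` O i = set0].
  apply: contrapT => H; apply: ndO => D D0 oD; apply/set0P/eqP => E.
  by apply: H; exists D.
have [y1 Dy1] := D0.
have [y2 [by2 Dy2]] : (ball y0 r `&` D) !=set0.
  have : closure (ball y0 r) y1.
    apply: contrapT => nc; have : (D `&` O i) y1 by split => //; right.
    by rewrite DO.
  by apply; exact: open_nbhs_nbhs.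
have /nbhs_ballP[d /= d0 dP] : nbhs y2 (ball y0 r `&` D).
  by apply: open_nbhs_nbhs; split => //; apply: openI => //; exact: ball_open.
exists y2, d; split => // [y /dP[]//|y /dP[by0 Dy]].
apply: contrapT => nA; have : (D `&` O i) y by split => //; left.
by rewrite DO.
Qed.

(** Lindelöf's argument: each basic open set contained in a member of G selects one such member, and
    [V0] is the default for the others. *)
Lemma second_countable_cover (T : topologicalType) (G : set (set T)) :
  [set: T] !=set0 -> @second_countable T -> (forall q : T, exists2 V, G V & nbhs q V) ->
  exists f : nat -> set T, (forall n, G (f n)) /\ forall q : T, exists n, f n q.
Proof.
move=> [q0 _] [B cB [_ Bb]] GP.
have [V0 GV0 _] := GP q0.
have /pfcard_geP[B0|[s]] := cB.
  have [V GV Vq] := GP q0; have [W /= [BW _] _] := Bb q0 V Vq.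
  by rewrite B0 in BW.
pose good W V := G V /\ W `<=` V.
exists (fun n => if pselect (exists V, good (s n) V) is left H then projT1 (cid H) else V0).
split => [n|q]; first by case: pselect => // H; case: (cid H) => V [].
have [V GV Vq] := GP q; have [W /= [BW Wq] WV] := Bb q V Vq.
have [n _ nW] := @surj _ _ _ _ s W BW.
exists n; case: pselect => [H|H]; last by exfalso; apply: H; exists V; rewrite nW.
by case: (cid H) => V' [gV hV] /=; apply: hV; rewrite nW.
Qed.

End Pigeonhole.

(** * The planar projection has rank at most one *)

Section Projection_rank.
Variable R : realType.

Lemma C1_strict (m : nat) (U : set 'rV[R]_2) (X : 'rV[R]_2 -> 'rV[R]_m.+1) u0 k (e : R) :
  open U -> C1_on U X -> U u0 -> 0 < e ->
  exists2 d : R, 0 < d /\ ball u0 d `<=` U & forall u v, ball u0 d u -> ball u0 d v ->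
    `|X u 0 k - X v 0 k - ((u - v) 0 0 * partial 0 X u0 0 k + (u - v) 0 1 * partial 1 X u0 0 k)|
      <= e * `|u - v|.
Proof.
move=> oU C1 Uu e0; have [r r0 rU] := open_ball_sub oU Uu.
have [_ pE cX] := C1_on_coord k oU C1 Uu.
have [u /rU Uu'||d /andP[d0 dr] dP] := @strict_diff R (fun v => X v 0 k) u0 r e r0 e0.
- by have [] := C1_on_coord k oU C1 Uu'.
- exact: cX.
exists d; first by split => // u /(le_ball dr)/rU.
by move=> u v bu bv; have := dP u v bu bv; rewrite -(pE 0) -(pE 1).
Qed.

Lemma C1_lipschitz (U : set 'rV[R]_2) (X : 'rV[R]_2 -> 'rV[R]_3) u0 :
  open U -> C1_on U X -> U u0 -> exists rho L : R, [/\ 0 < rho, 0 <= L,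
    forall u, `|u - u0| <= rho -> U u & forall u v, `|u - u0| <= rho -> `|v - u0| <= rho ->
      `|X u - X v| <= L * `|u - v|].
Proof.
move=> oU C1 Uu.
have [d dP] := choice (fun k => let: ex_intro2 d a b := C1_strict k oU C1 Uu ltr01 in
  ex_intro (fun d => (0 < d /\ ball u0 d `<=` U) /\ _) d (conj a b)).
pose r := Num.min (d 0) (Num.min (d 1) (d 2)).
have rd k : r <= d k.
  by move: k; apply: forall_I3; rewrite /r !ge_min lexx ?orbT.
have r0 : 0 < r by rewrite /r !lt_min !(dP _).1.1.
pose M k := `|partial 0 X u0 0 k| + `|partial 1 X u0 0 k| + 1.
have M0 k : 0 <= M k by rewrite /M !addr_ge0.
have inb k u : `|u - u0| <= r / 2 -> ball u0 (d k) u.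
  move=> ur; rewrite -ball_normE /= distrC; apply: le_lt_trans ur _.
  by apply: lt_le_trans (rd k); lra.
exists (r / 2), (M 0 + M 1 + M 2); split; first by rewrite divr_gt0.
- by rewrite !addr_ge0.
- by move=> u /(inb 0); exact: (dP 0).1.2.
move=> u v ur vr; apply: norm_le_coord; first by rewrite mulr_ge0 // !addr_ge0.
move=> k; apply: (@le_trans _ _ (M k * `|u - v|)); last first.
  apply: ler_wpM2r => //; move: (M0 0) (M0 1) (M0 2); move: k.
  by apply: forall_I3 => a b c; lra.
have := (dP k).2 u v (inb k u ur) (inb k v vr).
have n0 := coord_le_norm (u - v) 0; have n1 := coord_le_norm (u - v) 1.
have -> : (X u - X v) 0 k = X u 0 k - X v 0 k by rewrite !mxE.
rewrite /M; move: (partial 0 X u0 0 k) (partial 1 X u0 0 k) n0 n1.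
move: ((u - v) 0 0) ((u - v) 0 1) `|u - v| (X u 0 k) (X v 0 k) => a b w x y p q aw bw E.
rewrite -[x - y](subrK (a * p + b * q)); apply: le_trans (ler_normD _ _) _.
apply: le_trans (lerD E (ler_normD _ _)) _.
rewrite !normrM !mulrDl !mul1r addrC lerD2r.
by apply: lerD; rewrite mulrC; apply: ler_wpM2l.
Qed.

(** Cramer's rule for a linear system known up to an error e w. *)
Lemma solve2_bound (A B C D a b y0 y1 M w e : R) : 0 <= M -> 0 <= w -> 0 <= e ->
  `|y0| <= M -> `|y1| <= M -> `|y0 - (a * A + b * B)| <= e * w -> `|y1 - (a * C + b * D)| <= e * w ->
  let S := `|A| + `|B| + `|C| + `|D| in let J := A * D - B * C in
  `|a| * `|J| <= S * (M + e * w) /\ `|b| * `|J| <= S * (M + e * w).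
Proof.
move=> M0 w0 e0 yM0 yM1 E0 E1 S J.
have k0 : `|a * A + b * B| <= M + e * w.
  rewrite -[a * A + b * B](subKr y0); apply: le_trans (ler_normB _ _) _; exact: lerD.
have k1 : `|a * C + b * D| <= M + e * w.
  rewrite -[a * C + b * D](subKr y1); apply: le_trans (ler_normB _ _) _; exact: lerD.
have N0 : 0 <= M + e * w by rewrite addr_ge0 // mulr_ge0.
have comb p q : `|p| + `|q| <= S -> 
    `|p * (a * A + b * B) - q * (a * C + b * D)| <= S * (M + e * w).
  move=> pq; apply: le_trans (ler_normB _ _) _; rewrite !normrM.
  apply: (@le_trans _ _ ((`|p| + `|q|) * (M + e * w))); last exact: ler_wpM2r.
  by rewrite mulrDl; apply: lerD; exact: ler_wpM2l.
move: (normr_ge0 A) (normr_ge0 B) (normr_ge0 C) (normr_ge0 D) => nA nB nC nD.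
rewrite -!normrM; split.
  have -> : a * J = D * (a * A + b * B) - B * (a * C + b * D) by rewrite /J; ring.
  by apply: comb; rewrite /S; lra.
have -> : b * J = - C * (a * A + b * B) - (- A) * (a * C + b * D) by rewrite /J; ring.
by apply: comb; rewrite /S !normrN; lra.
Qed.

Let half_absorb (p s : R) : p <= s + p / 2 -> p / 2 <= s.
Proof. by move=> h; lra. Qed.

(** Quantitative injectivity from the inverse function theorem: where its Jacobian is nonzero, the
    planar part of X shrinks distances by at most a factor c. *)
Lemma planar_expanding (U : set 'rV[R]_2) (X : 'rV[R]_2 -> 'rV[R]_3) u0 :
  open U -> C1_on U X -> U u0 ->
  partial 0 X u0 0 0 * partial 1 X u0 0 1 - partial 0 X u0 0 1 * partial 1 X u0 0 0 != 0 ->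
  exists c d : R, [/\ 0 < c <= 1, 0 < d, ball u0 d `<=` U &
    forall u v M, ball u0 d u -> ball u0 d v ->
      `|X u 0 0 - X v 0 0| <= M -> `|X u 0 1 - X v 0 1| <= M -> c * `|u - v| <= M].
Proof.
move=> oU C1 Uu J0.
pose A := partial 0 X u0 0 0; pose B := partial 1 X u0 0 0.
pose C := partial 0 X u0 0 1; pose D := partial 1 X u0 0 1.
pose S := `|A| + `|B| + `|C| + `|D| + 1; pose J := `|A * D - B * C|.
have Jp : 0 < J by rewrite normr_gt0 (mulrC B).
have S0 : 1 <= S by rewrite lerDr !addr_ge0.
have Sp : 0 < S by apply: lt_le_trans S0.
(* With this e the error term S e |u - v| is half of J |u - v| and is absorbed on the left. *)
pose e := J / (2 * S).
have e0 : 0 < e by rewrite divr_gt0 // mulr_gt0.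
have [d [d0 dU] dP] := C1_strict 0 oU C1 Uu e0.
have [d' [d'0 d'U] d'P] := C1_strict 1 oU C1 Uu e0.
exists (Num.min e 1), (Num.min d d').
have rd : Num.min d d' <= d by rewrite ge_min lexx.
have rd' : Num.min d d' <= d' by rewrite ge_min lexx orbT.
split.
- by rewrite lt_min e0 ltr01 ge_min lexx orbT.
- by rewrite lt_min d0.
- by move=> u /(le_ball rd)/dU.
move=> u v M bu bv M0 M1.
have Mp : 0 <= M by apply: le_trans M0.
have [h0 h1] : `|(u - v) 0 0| * J <= (`|A| + `|B| + `|C| + `|D|) * (M + e * `|u - v|) /\
    `|(u - v) 0 1| * J <= (`|A| + `|B| + `|C| + `|D|) * (M + e * `|u - v|).
  exact: (solve2_bound Mp (normr_ge0 (u - v)) (ltW e0) M0 M1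
    (dP u v (le_ball rd bu) (le_ball rd bv)) (d'P u v (le_ball rd' bu) (le_ball rd' bv))).
have h : `|u - v| * J <= S * (M + e * `|u - v|).
  rewrite -ler_pdivlMr //; apply: norm_le_coord.
    by rewrite divr_ge0 ?(ltW Jp) // mulr_ge0 ?(ltW Sp) // addr_ge0 // mulr_ge0 // ltW.
  have N0 : 0 <= M + e * `|u - v| by rewrite addr_ge0 // mulr_ge0 // ltW.
  have up (z : R) : z * J <= (`|A| + `|B| + `|C| + `|D|) * (M + e * `|u - v|) ->
      z <= S * (M + e * `|u - v|) / J.
    rewrite ler_pdivlMr // => /le_trans; apply; apply: ler_wpM2r => //.
    by rewrite /S lerDl.
  by apply: forall_I2; apply: up.
apply: (@le_trans _ _ (e * `|u - v|)); first by apply: ler_wpM2r => //; rewrite ge_min lexx.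
have eS : S * (e * `|u - v|) = `|u - v| * J / 2 by rewrite /e; field; rewrite gt_eqF.
rewrite -(ler_pM2l Sp); rewrite mulrDr eS in h; rewrite eS.
exact: half_absorb h.
Qed.

Lemma nil_projE (p : 'rV[R]_3) : nil_proj p 0 0 = p 0 0 /\ nil_proj p 0 1 = p 0 1.
Proof. by split; rewrite mxE; congr (p _ _); exact/val_inj. Qed.

Lemma nil_proj_norm (p : 'rV[R]_3) : `|nil_proj p| <= `|p|.
Proof. by apply: norm_le_coord => // i; rewrite mxE; exact: coord_le_norm. Qed.

Lemma nil_projB (p q : 'rV[R]_3) : nil_proj p - nil_proj q = nil_proj (p - q).
Proof. by apply/rowP => i; rewrite !mxE. Qed.

Lemma nil_proj_continuous : continuous (@nil_proj R).
Proof.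
move=> p A /(@nbhs_ballP _ 'rV[R]_2)[e e0 eA]; apply/(@nbhs_ballP _ 'rV[R]_3).
exists e => // q bq; apply: eA; move: bq; rewrite -!ball_normE /= nil_projB.
by move=> /(le_lt_trans _); apply; exact: nil_proj_norm.
Qed.

Lemma planar_rank_lt2 (tau : R) (T : topologicalType) (F N : T -> 'rV[R]_3) U phi u0 :
  oriented_surface tau F N -> vertically_invariant (range F) ->
  local_param F U phi -> U u0 ->
  partial 0 (F \o phi) u0 0 0 * partial 1 (F \o phi) u0 0 1
    - partial 0 (F \o phi) u0 0 1 * partial 1 (F \o phi) u0 0 0 = 0.
Proof.
move=> surf inv [oU _ _ _ [[C1 _] _]] Uu; apply/eqP/negPn/negP => J0.
have [c [d [/andP[c0 c1] d0 dU expand]]] := planar_expanding oU C1 Uu J0.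
pose X := F \o phi.
(* [Psi] lifts the point of the sheet with parameter (y_0, y_1) to height y_2; invariance keeps it
   in range F. *)
pose Psi (y : 'rV[R]_3) := vertical_translation (y 0 2 - X (nil_proj y) 0 2) (X (nil_proj y)).
pose y0 : 'rV[R]_3 := \row_i (if i == 0 then u0 0 0 else if i == 1 then u0 0 1 else 0).
have y0E : nil_proj y0 = u0.
  by apply/rowP; elim/forall_I2; rewrite ?(nil_projE y0).1 ?(nil_projE y0).2 mxE.
have inb y : ball y0 d y -> ball u0 d (nil_proj y).
  rewrite -!ball_normE /= -y0E nil_projB => /(le_lt_trans _); apply; exact: nil_proj_norm.
have PsiE y : [/\ Psi y 0 0 = X (nil_proj y) 0 0, Psi y 0 1 = X (nil_proj y) 0 1 & Psi y 0 2 = y 0 2].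
  by rewrite /Psi /vertical_translation; split; rewrite !mxE /=; ring.
(* Closed squares of charts on which F is Lipschitz. Their images under F are compact, hence closed
   as Baire's theorem requires. *)
pose G V := exists U phi w0 rho L, [/\ local_param F U phi, 0 < rho, 0 <= L,
  forall w, `|w - w0| <= rho -> U w & (forall w w', `|w - w0| <= rho -> `|w' - w0| <= rho ->
    `|F (phi w) - F (phi w')| <= L * `|w - w'|) /\ V = phi @` [set w | `|w - w0| <= rho]].
have [f [fG fcov]] : exists f : nat -> set T, (forall n, G (f n)) /\ forall q : T, exists n, f n q.
  apply: second_countable_cover; [exact: surface_nonempty surf|exact: surface_second_countable surf|].
  move=> q; have [V [psi [pV [w Vw wq]]]] := surface_param surf q.
  have [oV _ _ openpsi [[D1 _] _]] := pV.
  have [rho [L [rho0 L0 rV lip]]] := C1_lipschitz oV D1 Vw.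
  exists (psi @` [set w' | `|w' - w| <= rho]); first by exists V, psi, w, rho, L.
  apply: (@filterS _ _ _ (psi @` ball w rho)).
    by move=> _ [v bv <-]; exists v => //=; move: bv; rewrite -ball_normE /= distrC => /ltW.
  apply: open_nbhs_nbhs; split.
    apply: openpsi; last exact: ball_open.
    by move=> v; rewrite -ball_normE /= distrC => /ltW/rV.
  by exists w => //; exact: ballxx.
have Acl n : closed (F @` f n).
  have [V [psi [w0 [rho [L [[_ _ _ _ [[D1 _] _]] rho0 L0 rV [_ ->]]]]]]] := fG n.
  apply: compact_closed; first exact: norm_hausdorff.
  rewrite image_comp; apply: continuous_compact.
    apply: continuous_in_subspaceT => w /set_mem wr; have Vw := rV w wr.
    by apply: differentiable_continuous; exact: (D1 w Vw).1.
  apply: bounded_closed_compact.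
    exists (`|w0| + rho); split; first exact: num_real.
    move=> M MM w /= wr; apply: le_trans (ltW MM).
    by rewrite -[w](subrK w0) addrC; apply: le_trans (ler_normD _ _) _; rewrite lerD2l.
  have -> : [set w | `|w - w0| <= rho] = closed_ball w0 rho.
    by rewrite closed_ballE //; apply/seteqP; split => w; rewrite /closed_ball_ /= distrC.
  exact: closed_ball_closed.
have Pcov y : ball y0 d y -> exists i, (F @` f i) (Psi y).
  move=> by0; have : range F (Psi y).
    rewrite -(inv (y 0 2 - X (nil_proj y) 0 2)); exists (X (nil_proj y)) => //.
  by move=> [q _ <-]; have [n fq] := fcov q; exists n; exists q.
have Pcont y : ball y0 d y -> {for y, continuous Psi}.
  move=> by0; have Xc : {for y, continuous (X \o @nil_proj R)}.
    apply: continuous_comp; first exact: nil_proj_continuous.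
    by apply: differentiable_continuous; apply: (C1 _ _).1; apply: dU; exact: inb.
  have kc (n : nat) (M : 'rV[R]_3) : {for M, continuous (fun M : 'rV[R]_3 => M 0 2)}.
    exact: coord_continuous.
  have X2 : {for y, continuous (fun y => (X (nil_proj y)) 0 2)}.
    exact: (continuous_comp Xc (@coord_continuous R 1 3 0 2 _)).
  exact: (cvgD Xc (cvgZ (cvgB (@coord_continuous R 1 3 0 2 y) X2) (cvg_cst _))).
have [i [y1 [e [e0 ed eP]]]] := Baire_cover d0 Pcont Acl Pcov.
have [V [psi [w0 [rho [L [_ rho0 L0 rV [lip fE]]]]]]] := fG i.
apply: (no_cube_in_square (Y := F \o psi) (w0 := w0) (Psi := Psi) (y0 := y1) e0 c0 rho0 L0).
- move=> y y' /ed by1 /ed by2; rewrite -ler_pdivlMl //.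
  apply: norm_le_coord; first by rewrite mulr_ge0 // invr_ge0 ltW.
  have [p0 p1 p2] := PsiE y; have [q0 q1 q2] := PsiE y'.
  have b k : `|Psi y 0 k - Psi y' 0 k| <= `|Psi y - Psi y'|.
    by have := coord_le_norm (Psi y - Psi y') k; rewrite !mxE.
  have E : c * `|nil_proj y - nil_proj y'| <= `|Psi y - Psi y'|.
    apply: expand; [exact: inb|exact: inb| |].
      by have := b 0; rewrite p0 q0.
    by have := b 1; rewrite p1 q1.
  have E' k : `|(nil_proj y - nil_proj y') 0 k| <= c^-1 * `|Psi y - Psi y'|.
    by apply: le_trans (coord_le_norm _ k) _; rewrite ler_pdivlMl.
  rewrite nil_projB in E'.
  apply: forall_I3.
  + by rewrite -(nil_projE (y - y')).1; exact: E'.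
  + by rewrite -(nil_projE (y - y')).2; exact: E'.
  + have -> : (y - y') 0 2 = Psi y 0 2 - Psi y' 0 2 by rewrite p2 q2 !mxE.
    apply: le_trans (b 2) _; rewrite ler_peMl // invf_ge1 //.
- exact: lip.
- move=> y /eP; rewrite fE => -[_ [w wr <-] FE].
  by exists w.
Qed.

End Projection_rank.

(** * Connectedness and the intermediate value theorem *)

Lemma locally_constant_connected (T : topologicalType) (V : Type) (v : T -> V) :
  connected [set: T] -> (forall q, \forall q' \near q, v q' = v q) ->
  forall q q', v q = v q'.
Proof.
move=> cT loc q q'.
have op (P : V -> Prop) : open [set x | P (v x)].
  rewrite openE => x Px; apply: filterS (loc x) => y /= ->; exact: Px.
have : [set x | v x = v q'] = [set: T].
  apply: cT; first by exists q'.
    by exists [set x | v x = v q']; [exact: (op (fun z => z = v q'))|rewrite setTI].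
  exists [set x | v x = v q']; last by rewrite setTI.
  have -> : [set x | v x = v q'] = ~` [set x | v x <> v q'].
    by apply/seteqP; split => x /= H; [move=> /(_ H)|exact: contrapT].
  by apply: open_closedC; exact: (op (fun z => z <> v q')).
by move=> E; have : [set x | v x = v q'] q by rewrite E.
Qed.

Lemma derive_covers (R : realType) (f : R -> R) (r0 c : R) : 0 < r0 -> c != 0 ->
  (forall x : R, `|x| < r0 -> derivable f x 1) -> is_derive (0 : R) 1 f c ->
  exists2 e : R, 0 < e & forall y, `|y - f 0| < e -> exists2 x, `|x| < r0 & f x = y.
Proof.
move=> r00 c0 df d0.
(* The positive product says that f 0 lies strictly between f (- s) and f s, whatever the sign of
   c. *)
have [s [s0 sr sP]] : exists s : R, [/\ 0 < s, s < r0 & (f s - f 0) * (f 0 - f (- s)) > 0].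
  have q : (fun h : R => h^-1 *: (f (h *: 1 + 0) - f 0)) @ 0^' --> c.
    by case: d0 => d <-.
  have c2 : 0 < `|c| by rewrite normr_gt0.
  move/cvgrPdist_lt : q => /(_ _ c2)[e /= e0 eP].
  have s0 : 0 < Num.min e r0 / 2 by rewrite divr_gt0 // lt_min e0.
  have me : Num.min e r0 <= e by rewrite ge_min lexx.
  have mr : Num.min e r0 <= r0 by rewrite ge_min lexx orbT.
  set s := Num.min e r0 / 2 in s0 *.
  have se : s < e by rewrite /s in s0 *; lra.
  exists s; split => //; first by rewrite /s in s0 *; lra.
  have H h : `|h| = s -> 0 < c * (h^-1 * (f h - f 0)).
    move=> hs; have hn : h != 0 by rewrite -normr_gt0 hs.
    have := eP h; rewrite /ball_ /= sub0r normrN hs => /(_ se hn).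
    rewrite /GRing.scale /= mulr1 addr0 => E.
    case: (ltgtP c 0) c0 E => // cs _.
      by rewrite (ltr0_norm cs) ltr_norml => /andP[E1 E2]; rewrite nmulr_rgt0 //; lra.
    by rewrite (gtr0_norm cs) ltr_norml => /andP[E1 E2]; rewrite pmulr_rgt0 //; lra.
  have /H Hs : `|s| = s by rewrite gtr0_norm.
  have /H Hns : `|- s| = s by rewrite normrN gtr0_norm.
  have := mulr_gt0 Hs Hns.
  have -> : c * (s^-1 * (f s - f 0)) * (c * ((- s)^-1 * (f (- s) - f 0))) =
     (c / s) ^+ 2 * ((f s - f 0) * (f 0 - f (- s))) by field; rewrite gt_eqF.
  by rewrite pmulr_rgt0 // exprn_even_gt0 //= mulf_neq0 // invr_eq0 gt_eqF.
have p1 : f s - f 0 != 0 by apply: contraTneq sP => ->; rewrite mul0r ltxx.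
have p2 : f 0 - f (- s) != 0 by apply: contraTneq sP => ->; rewrite mulr0 ltxx.
exists (Num.min `|f s - f 0| `|f 0 - f (- s)|); first by rewrite lt_min !normr_gt0 p1 p2.
move=> y; rewrite lt_min => /andP[y1 y2].
have [||| x xs xy] := @IVT R f (- s) s y; [lra| | |].
- apply: derivable_within_continuous => x; rewrite in_itv /= => /andP[x1 x2].
  by apply: df; rewrite ltr_norml; apply/andP; split; lra.
- move: y1 y2; rewrite !ltr_norml ge_min le_max.
  case: (ltgtP (f s - f 0) 0) p1 sP => // h _ sP.
    have h' : f 0 - f (- s) < 0 by rewrite -(nmulr_rgt0 _ h).
    rewrite (ltr0_norm h) (ltr0_norm h') => /andP[a1 a2] /andP[b1 b2].
    by apply/andP; split; apply/orP; [right|left]; lra.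
  have h' : 0 < f 0 - f (- s) by rewrite -(pmulr_rgt0 _ h).
  rewrite (gtr0_norm h) (gtr0_norm h') => /andP[a1 a2] /andP[b1 b2].
  by apply/andP; split; apply/orP; [left|right]; lra.
- exists x => //; move: xs; rewrite in_itv /= => /andP[x1 x2].
  by rewrite ltr_norml; apply/andP; split; lra.
Qed.

Lemma is_deriveMc (R : realType) (f : R -> R) (s d c : R) :
  is_derive s 1 f d -> is_derive s 1 (fun x => f x * c) (d * c).
Proof.
move=> D; apply: (is_derive_eq (is_deriveM D (is_derive_cst c s 1))).
by rewrite scaler0 add0r /GRing.scale /= mulrC.
Qed.

(** * From charts to the whole surface *)

Section Surface.
Variables (R : realType) (tau lambda : R) (T : topologicalType) (F N : T -> 'rV[R]_3).
Hypotheses (surfF : oriented_surface tau F N) (transF : translator tau lambda F N)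
  (invF : vertically_invariant (range F)).

(** F read in a chart is continuous and charts are open maps. *)
Lemma surface_continuous : continuous F.
Proof.
move=> q; have [U [phi [pF [u Uu uq]]]] := surface_param surfF q.
have [oU _ _ opn [[C1 _] _]] := pF.
move=> A; rewrite -uq => nA.
have cX : {for u, continuous (F \o phi)} by apply: differentiable_continuous; exact: (C1 u Uu).1.
have /(cX A) : nbhs ((F \o phi) u) A by [].
rewrite nbhs_filterE => nX.
have [V [oV Vu] VA] : exists2 V, open V /\ V u & V `<=` U `&` (F \o phi) @^-1` A.
  have : nbhs u (U `&` (F \o phi) @^-1` A) by apply: filterI => //; exact: open_nbhs_nbhs.
  by rewrite nbhsE => -[V [oV Vu] VA]; exists V.
apply: (@filterS _ _ _ (phi @` V)); first by move=> _ [v /VA[_ Av] <-].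
by apply: open_nbhs_nbhs; split; [apply: opn => // v /VA[]|exists u].
Qed.

Section Param.
Variables (U : set 'rV[R]_2) (phi : 'rV[R]_2 -> T).
Hypothesis pF : local_param F U phi.

Let oU : open U. Proof. by case: pF. Qed.
Let C2 : C2_on U (F \o phi). Proof. by case: pF => ? ? ? ? []. Qed.
Let imm : immersion_on U (F \o phi). Proof. by case: pF => ? ? ? ? []. Qed.
Let det0 u : U u -> partial 0 (F \o phi) u 0 0 * partial 1 (F \o phi) u 0 1
    - partial 0 (F \o phi) u 0 1 * partial 1 (F \o phi) u 0 0 = 0.
Proof. exact: planar_rank_lt2 surfF invF pF. Qed.
Let unit u : U u -> nil_metric tau ((F \o phi) u) ((N \o phi) u) ((N \o phi) u) = 1.
Proof. by move=> _; exact: (normal_unit surfF). Qed.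
Let orth u i : U u -> nil_metric tau ((F \o phi) u) (partial i (F \o phi) u) ((N \o phi) u) = 0.
Proof. by move=> Uu; exact: (normal_orthogonal surfF pF Uu). Qed.
Let ncont u : U u -> {for u, continuous (N \o phi)}.
Proof.
move=> Uu; case: pF => _ cphi _ _ _; apply: continuous_comp; first exact: cphi (mem_set Uu).
exact: (normal_continuous surfF).
Qed.
Let nmean u : U u -> mean_curvature tau (F \o phi) ((N \o phi) u) u =
  nil_metric tau ((F \o phi) u) ((N \o phi) u) (basis_vec R 2) + lambda.
Proof. by move=> Uu; exact (transF pF Uu). Qed.

Lemma param_normal u : U u -> N (phi u) 0 0 ^+ 2 + N (phi u) 0 1 ^+ 2 = 1.
Proof. by move=> Uu; have [h []] := chart_vertical imm det0 unit orth Uu. Qed.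

Lemma param_open_ball u (r : R) : ball u r `<=` U -> 0 < r -> nbhs (phi u) (phi @` ball u r).
Proof.
move=> rU r0; apply: open_nbhs_nbhs; split; last by exists u => //; exact: ballxx.
by case: pF => _ _ _ opn _; apply: opn => //; exact: ball_open.
Qed.

Lemma param_translate u (k := 2 * lambda) : U u ->
  \forall q \near phi u, N q 0 0 + k * F q 0 0 = N (phi u) 0 0 + k * F (phi u) 0 0 /\
    N q 0 1 + k * F q 0 1 = N (phi u) 0 1 + k * F (phi u) 0 1.
Proof.
move=> Uu; have [r [r0 rU rP]] := chart_gauss_translate oU C2 imm det0 unit orth ncont nmean Uu.
by apply: filterS (param_open_ball rU r0) => _ [v bv <-]; exact: rP.
Qed.

Lemma param_quadric u (W0 W1 : R) (k := 2 * lambda)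
    (Q := fun q => k * (F q 0 0 * F q 0 0 + F q 0 1 * F q 0 1) - 2 * (W0 * F q 0 0 + W1 * F q 0 1)) :
  (forall q, N q 0 0 + k * F q 0 0 = W0 /\ N q 0 1 + k * F q 0 1 = W1) -> U u ->
  \forall q \near phi u, Q q = Q (phi u).
Proof.
move=> WE Uu; have [r r0 rU] := open_ball_sub oU Uu.
apply: filterS (param_open_ball rU r0) => _ [v bv <-].
apply: (chart_quadric (n := N \o phi) oU C2 imm det0 unit orth _ rU bv (ballxx _ r0)) => w _.
exact: WE.
Qed.

(** The tangential coordinate f has derivative [h i] along the i-th coordinate line, nonzero for
    some i, so [derive_covers] applies on that line. *)
Lemma param_tangential u A : U u -> nbhs (phi u) A ->
  let f q := F q 0 0 * N (phi u) 0 1 - F q 0 1 * N (phi u) 0 0 in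
  exists2 e : R, 0 < e & forall y, `|y - f (phi u)| < e -> exists2 q, A q & f q = y.
Proof.
move=> Uu nA f.
have cphi : {for u, continuous phi} by case: pF => _ c _ _ _; exact: c (mem_set Uu).
have [r r0 rUA] : exists2 r : R, 0 < r & ball u r `<=` U `&` phi @^-1` A.
  have /nbhs_ballP[r r0 rP] : nbhs u (U `&` phi @^-1` A).
    by apply: filterI; [exact: open_nbhs_nbhs|exact: cphi].
  by exists r.
have [i hi] := chart_h_neq0 imm det0 unit orth Uu.
pose l (s : R) := u + s *: basis_vec R i.
have inb s : `|s| < r -> ball u r (l s).
  move=> sr; rewrite -ball_normE /= /l opprD addrA subrr add0r normrN normrZ.
  by apply: le_lt_trans sr; rewrite -[leRHS]mulr1; apply: ler_wpM2l => //; exact: norm_basis_le.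
have D (k : 'I_3) (s : R) : `|s| < r -> is_derive s 1 (fun s : R => F (phi (l s)) 0 k) (partial i (F \o phi) (l s) 0 k).
  move=> /inb /rUA[Us _]; have [d p] := chart_first oU C2 k Us.
  have := is_derive_line d.
  have := basis_line i (fun v => (F \o phi) v 0 k) (l s) 1.
  by rewrite scale1r mul1r => ->; rewrite p.
pose c := partial i (F \o phi) u 0 0 * N (phi u) 0 1 - partial i (F \o phi) u 0 1 * N (phi u) 0 0.
have l0 : l 0 = u by rewrite /l scale0r addr0.
have Df (s : R) : `|s| < r -> is_derive s 1 (fun s : R => f (phi (l s)))
    (partial i (F \o phi) (l s) 0 0 * N (phi u) 0 1 - partial i (F \o phi) (l s) 0 1 * N (phi u) 0 0).
  by move=> sr; exact: (is_deriveB (is_deriveMc _ (D 0 s sr)) (is_deriveMc _ (D 1 s sr))).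
have [|||e e0 eP] := @derive_covers R (fun s => f (phi (l s))) r c r0.
- exact: hi.
- by move=> s /Df[].
- by have := Df 0; rewrite normr0 l0 => /(_ r0).
exists e => // y; rewrite l0 in eP => /eP[s sr <-].
by exists (phi (l s)) => //; have /rUA[] := inb s sr.
Qed.

End Param.

Lemma normal_planar_unit q : N q 0 0 ^+ 2 + N q 0 1 ^+ 2 = 1.
Proof.
have [U [phi [pF [u Uu <-]]]] := surface_param surfF q; exact: param_normal pF _ Uu.
Qed.

Lemma tangential_surjective q A : nbhs q A ->
  let f q' := F q' 0 0 * N q 0 1 - F q' 0 1 * N q 0 0 in
  exists2 e : R, 0 < e & forall y, `|y - f q| < e -> exists2 q', A q' & f q' = y.
Proof.
have [U [phi [pF [u Uu <-]]]] := surface_param surfF q.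
by move=> nA; exact: (param_tangential pF Uu nA).
Qed.

Lemma global_translate (k := 2 * lambda) q q' :
  N q 0 0 + k * F q 0 0 = N q' 0 0 + k * F q' 0 0 /\
  N q 0 1 + k * F q 0 1 = N q' 0 1 + k * F q' 0 1.
Proof.
pose v q := (N q 0 0 + k * F q 0 0, N q 0 1 + k * F q 0 1).
suff : v q = v q' by case=> -> ->.
apply: locally_constant_connected; first exact: surface_connected surfF.
move=> x; have [U [phi [pF [u Uu <-]]]] := surface_param surfF x.
by apply: filterS (param_translate pF Uu) => y [e0 e1]; rewrite /v e0 e1.
Qed.

Lemma global_quadric (k := 2 * lambda) (W0 W1 : R)
    (Q := fun q => k * (F q 0 0 * F q 0 0 + F q 0 1 * F q 0 1) - 2 * (W0 * F q 0 0 + W1 * F q 0 1)) :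
  (forall q, N q 0 0 + k * F q 0 0 = W0 /\ N q 0 1 + k * F q 0 1 = W1) ->
  forall q q', Q q = Q q'.
Proof.
move=> WE; apply: locally_constant_connected; first exact: surface_connected surfF.
move=> x; have [U [phi [pF [u Uu <-]]]] := surface_param surfF x.
exact: (param_quadric pF (u := u) WE Uu).
Qed.

End Surface.

(** * Circles and lines parametrized by arc length *)

Section Arc.
Variable R : realType.

Definition row2 (x y : R) : 'rV[R]_2 := \row_i (if i == 0 then x else y).

Lemma row2_0 x y : row2 x y 0 0 = x. Proof. by rewrite mxE. Qed.
Lemma row2_1 x y : row2 x y 0 1 = y. Proof. by rewrite mxE. Qed.

Lemma row2P (u v : 'rV[R]_2) : u 0 0 = v 0 0 -> u 0 1 = v 0 1 -> u = v.
Proof. by move=> e0 e1; apply/rowP; apply: forall_I2. Qed.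

Lemma is_derive_row2 (f g : R -> R) (s f' g' : R) :
  is_derive s 1 f f' -> is_derive s 1 g g' ->
  is_derive s 1 (fun x => row2 (f x) (g x)) (row2 f' g').
Proof.
move=> [df ef] [dg eg].
have E0 : (fun x => row2 (f x) (g x) 0 0) = f by apply/funext => x; rewrite row2_0.
have E1 : (fun x => row2 (f x) (g x) 0 1) = g by apply/funext => x; rewrite row2_1.
have d : derivable (fun x => row2 (f x) (g x)) s 1.
  apply/derivable_mxP => i j; rewrite ord1; move: j; apply: forall_I2; first by rewrite E0.
  by rewrite E1.
apply: DeriveDef => //; rewrite derive_mx //; apply: row2P; rewrite mxE.
  by rewrite E0 row2_0.
by rewrite E1 row2_1.
Qed.

Lemma circle_angle (x y : R) : x ^+ 2 + y ^+ 2 = 1 -> ~ (x = 1 /\ y = 0) ->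
  exists th : R, [/\ 0 < th < pi *+ 2, cos th = x & sin th = y].
Proof.
move=> xy ne.
have x1 : -1 <= x <= 1.
  have : x ^+ 2 <= 1 by rewrite -xy lerDl sqr_ge0.
  by rewrite expr2 => h; apply/andP; split; nra.
have xn : x < 1.
  rewrite lt_neqAle; case/andP: x1 => _ ->; rewrite andbT; apply/eqP => x1; apply: ne; split => //.
  by apply/eqP; rewrite -sqrf_eq0; apply/eqP; move: xy; rewrite x1; lra.
have xn1 : -1 <= x < 1 by case/andP: x1 => ->.
have th0 := acos_gt0 xn1; have thpi := acos_lepi x1.
have ys : y ^+ 2 = 1 - x ^+ 2 by lra.
have sa : sin (acos x) = `|y| by rewrite sin_acos // -ys sqrtr_sqr.
have pi0 := pi_gt0 R.
have ca : cos (acos x) = x by rewrite acosK // in_itv.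
case: (leP 0 y) => y0.
  exists (acos x); split => //; last by rewrite sa ger0_norm.
  by rewrite th0 /= mulr2n; lra.
exists (pi *+ 2 - acos x); split.
- by rewrite mulr2n; apply/andP; split; lra.
- by rewrite cosB cos2pi sin2pi ca; lra.
- by rewrite sinB cos2pi sin2pi sa ltr0_norm //; lra.
Qed.

(** [csin] and [cver] are the tangential and normal coordinates along a curve of curvature k; the
    values at k = 0 are the limits, so lines and circles are treated together. *)
Definition csin (k s : R) : R := if k == 0 then s else sin (k * s) / k.
Definition cver (k s : R) : R := if k == 0 then 0 else (1 - cos (k * s)) / k.

Lemma k_csin (k s : R) : k * csin k s = sin (k * s).
Proof.
rewrite /csin; case: eqVneq => [->|k0]; first by rewrite !mul0r sin0.
by rewrite mulrC divfK.
Qed.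

Lemma k_cver (k s : R) : k * cver k s = 1 - cos (k * s).
Proof.
rewrite /cver; case: eqVneq => [->|k0]; first by rewrite !mul0r cos0 subrr.
by rewrite mulrC divfK.
Qed.

Lemma is_derive_cosk (k s : R) : is_derive s 1 (fun s : R => cos (k * s)) (- k * sin (k * s)).
Proof.
have l : is_derive s 1 (fun s : R => k * s) k.
  by apply: (is_derive_eq (is_deriveM (is_derive_cst k s 1) (is_derive_id s 1)));
    rewrite scaler0 addr0 /GRing.scale /= mulr1.
by apply: (is_derive_eq (is_derive1_comp (is_derive_cos (k * s)) l)); ring.
Qed.

Lemma is_derive_sink (k s : R) : is_derive s 1 (fun s : R => sin (k * s)) (k * cos (k * s)).
Proof.
have l : is_derive s 1 (fun s : R => k * s) k.
  by apply: (is_derive_eq (is_deriveM (is_derive_cst k s 1) (is_derive_id s 1)));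
    rewrite scaler0 addr0 /GRing.scale /= mulr1.
by apply: (is_derive_eq (is_derive1_comp (is_derive_sin (k * s)) l)); ring.
Qed.

Lemma is_derive_csin (k s : R) : is_derive s 1 (csin k) (cos (k * s)).
Proof.
rewrite /csin; case: eqVneq => [->|k0].
  by rewrite mul0r cos0; exact: is_derive_id.
by apply: (is_derive_eq (is_deriveMc _ (is_derive_sink k s))); field.
Qed.

Lemma is_derive_cver (k s : R) : is_derive s 1 (cver k) (sin (k * s)).
Proof.
rewrite /cver; case: eqVneq => [->|k0].
  by rewrite mul0r sin0; exact: is_derive_cst.
have D := is_deriveB (is_derive_cst (1 : R) s 1) (is_derive_cosk k s).
by apply: (is_derive_eq (is_deriveMc _ D)); rewrite sub0r; field.
Qed.

(** The frame at p consists of the tangent (n_1, - n_0), whose quarter turn is n, and of n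
    itself. *)
Definition frame_comb (p n : 'rV[R]_2) (f g : R -> R) (s : R) : 'rV[R]_2 :=
  row2 (p 0 0 + (f s * n 0 1 + g s * n 0 0)) (p 0 1 + (f s * - n 0 0 + g s * n 0 1)).

Lemma is_derive_comb (p n : 'rV[R]_2) (f g f' g' : R -> R) (s : R) :
  is_derive s 1 f (f' s) -> is_derive s 1 g (g' s) ->
  is_derive s 1 (frame_comb p n f g) (frame_comb 0 n f' g' s).
Proof.
move=> df dg; apply: is_derive_row2; rewrite mxE.
- exact: is_deriveD (is_derive_cst (p 0 0) s 1)
    (is_deriveD (is_deriveMc (n 0 1) df) (is_deriveMc (n 0 0) dg)).
- exact: is_deriveD (is_derive_cst (p 0 1) s 1)
    (is_deriveD (is_deriveMc (- n 0 0) df) (is_deriveMc (n 0 1) dg)).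
Qed.

Definition circle_arc (k : R) (p n : 'rV[R]_2) : R -> 'rV[R]_2 := frame_comb p n (csin k) (cver k).

Variables (k : R) (p n : 'rV[R]_2).
Hypothesis n_unit : n 0 0 ^+ 2 + n 0 1 ^+ 2 = 1.

Lemma arc_deriv (s : R) : is_derive s 1 (circle_arc k p n) (frame_comb 0 n (fun s => cos (k * s)) (fun s => sin (k * s)) s).
Proof.
exact: (is_derive_comb p n (f' := fun s => cos (k * s)) (g' := fun s => sin (k * s)) (is_derive_csin k s) (is_derive_cver k s)).
Qed.

Lemma derive1_arc : derive1 (circle_arc k p n) = frame_comb 0 n (fun s => cos (k * s)) (fun s => sin (k * s)).
Proof. by apply/funext => s; rewrite derive1E; have [_ ->] := arc_deriv s. Qed.

Lemma derive1_arc_deriv (s : R) : is_derive s 1 (derive1 (circle_arc k p n))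
  (frame_comb 0 n (fun s => - k * sin (k * s)) (fun s => k * cos (k * s)) s).
Proof.
rewrite derive1_arc.
exact: (is_derive_comb 0 n (f' := fun s => - k * sin (k * s)) (g' := fun s => k * cos (k * s))
  (is_derive_cosk k s) (is_derive_sink k s)).
Qed.

Lemma rot90_arc s : rot90 (derive1 (circle_arc k p n) s) = n - k *: (circle_arc k p n s - p).
Proof.
have kS := k_csin k s; have kV := k_cver k s.
rewrite derive1_arc; apply: row2P; rewrite /rot90 /frame_comb /circle_arc /frame_comb !mxE /=.
  transitivity (n 0 0 - (k * csin k s * n 0 1 + k * cver k s * n 0 0)); last by ring.
  by rewrite kS kV; ring.
transitivity (n 0 1 - (k * csin k s * - n 0 0 + k * cver k s * n 0 1)); last by ring.
by rewrite kS kV; ring.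
Qed.

Lemma arc_arclength : arclength_curve (circle_arc k p n).
Proof.
move=> s; split; first by have [] := arc_deriv s.
  by have [] := derive1_arc_deriv s.
rewrite derive1_arc /dot2 /frame_comb !mxE /=.
transitivity ((cos (k * s) ^+ 2 + sin (k * s) ^+ 2) * (n 0 0 ^+ 2 + n 0 1 ^+ 2)); first by ring.
by rewrite cos2Dsin2 n_unit mulr1.
Qed.

Lemma arc_curvature s : curvature (circle_arc k p n) s = k.
Proof.
change (dot2 (derive1 (derive1 (circle_arc k p n)) s) (rot90 (derive1 (circle_arc k p n) s)) = k); rewrite [in X in dot2 X]derive1E.
have [_ ->] := derive1_arc_deriv s; rewrite derive1_arc /dot2 /rot90 /frame_comb !mxE /=.
transitivity (k * (cos (k * s) ^+ 2 + sin (k * s) ^+ 2) * (n 0 0 ^+ 2 + n 0 1 ^+ 2)); first by ring.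
by rewrite cos2Dsin2 n_unit !mulr1.
Qed.

(** The circle through p with centre p + n / k, or the line through p orthogonal to n when k = 0. *)
Definition on_conic (q : 'rV[R]_2) := k * dot2 (q - p) (q - p) = 2 * dot2 n (q - p).

Let cx (q : 'rV[R]_2) := (q - p) 0 0 * n 0 1 - (q - p) 0 1 * n 0 0.
Let cy (q : 'rV[R]_2) := (q - p) 0 0 * n 0 0 + (q - p) 0 1 * n 0 1.

Lemma coords_arc s : cx (circle_arc k p n s) = csin k s /\ cy (circle_arc k p n s) = cver k s.
Proof.
rewrite /cx /cy /circle_arc /frame_comb !mxE /=; split.
  by rewrite -[RHS]mulr1 -n_unit; ring.
by rewrite -[RHS]mulr1 -n_unit; ring.
Qed.

Lemma coords_inj q q' : cx q = cx q' -> cy q = cy q' -> q = q'.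
Proof.
move=> ex ey.
have E0 r : (r - p) 0 0 = cx r * n 0 1 + cy r * n 0 0.
  by rewrite -[LHS]mulr1 -n_unit /cx /cy; ring.
have E1 r : (r - p) 0 1 = cy r * n 0 1 - cx r * n 0 0.
  by rewrite -[LHS]mulr1 -n_unit /cx /cy; ring.
apply: (addIr (- p)); apply: row2P; first by rewrite !E0 ex ey.
by rewrite !E1 ex ey.
Qed.

Lemma on_conicE q : on_conic q <-> k * (cx q ^+ 2 + cy q ^+ 2) = 2 * cy q.
Proof.
rewrite /on_conic /dot2.
have -> : cx q ^+ 2 + cy q ^+ 2 = (q - p) 0 0 * (q - p) 0 0 + (q - p) 0 1 * (q - p) 0 1.
  by rewrite -[RHS]mulr1 -n_unit /cx /cy; ring.
by rewrite /cy (mulrC (n 0 0)) (mulrC (n 0 1)).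
Qed.

Lemma on_conic_unit q : on_conic q -> (1 - k * cy q) ^+ 2 + (k * cx q) ^+ 2 = 1.
Proof.
move=> /on_conicE E.
have -> : (1 - k * cy q) ^+ 2 + (k * cx q) ^+ 2 = 1 + k * (k * (cx q ^+ 2 + cy q ^+ 2) - 2 * cy q) by ring.
by rewrite E subrr mulr0 addr0.
Qed.

Lemma arc_on_conic s : on_conic (circle_arc k p n s).
Proof.
apply/on_conicE; have [-> ->] := coords_arc s.
have [k0|k0] := eqVneq k 0; first by rewrite /cver k0 eqxx mul0r mulr0.
apply: (mulfI k0).
transitivity ((k * csin k s) ^+ 2 + (k * cver k s) ^+ 2); first by ring.
transitivity (2 * (k * cver k s)); last by ring.
rewrite k_csin k_cver.
transitivity (sin (k * s) ^+ 2 + cos (k * s) ^+ 2 + (1 - 2 * cos (k * s))); first by ring.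
by rewrite addrC (addrC (sin _ ^+ 2)) cos2Dsin2; ring.
Qed.

(** A circle cut open at the parameter s0 is covered by one period. The window is stated on k (s -
    s0), so for negative k it lies below s0. *)
Lemma conic_arc_shift q s0 : k != 0 -> on_conic q -> q <> circle_arc k p n s0 ->
  exists s, 0 < k * (s - s0) < pi *+ 2 /\ q = circle_arc k p n s.
Proof.
move=> k0 cq ne; have u := on_conic_unit cq.
set X := 1 - k * cy q in u *; set Y := k * cx q in u *.
have cs := cos2Dsin2 (k * s0).
set c := cos (k * s0) in cs *; set d := sin (k * s0) in cs *.
(* (X, Y) is the cosine and sine of the angle of q; rotating by - k s0 measures it from the cut
   point. *)
have [||th [thI cth sth]] := @circle_angle (c * X + d * Y) (c * Y - d * X).
- transitivity ((c ^+ 2 + d ^+ 2) * (X ^+ 2 + Y ^+ 2)); first by ring.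
  by rewrite cs u mulr1.
- move=> [e1 e2]; apply: ne.
  have Xc : X = c.
    transitivity ((c ^+ 2 + d ^+ 2) * X); first by rewrite cs mul1r.
    transitivity (c * (c * X + d * Y) - d * (c * Y - d * X)); first by ring.
    by rewrite e1 e2; ring.
  have Yd : Y = d.
    transitivity ((c ^+ 2 + d ^+ 2) * Y); first by rewrite cs mul1r.
    transitivity (d * (c * X + d * Y) + c * (c * Y - d * X)); first by ring.
    by rewrite e1 e2; ring.
  have [ax ay] := coords_arc s0; apply: coords_inj; apply: (mulfI k0).
    by rewrite ax k_csin.
  by rewrite ay k_cver -/c -Xc /X; ring.
exists (s0 + th / k).
have E : k * (s0 + th / k) = k * s0 + th by field.
split; first by have -> : k * (s0 + th / k - s0) = th by field.
have [ax ay] := coords_arc (s0 + th / k); apply: coords_inj; apply: (mulfI k0).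
  rewrite ax k_csin E sinD cth sth -/c -/d -/Y.
  transitivity ((c ^+ 2 + d ^+ 2) * Y); first by rewrite cs mul1r.
  by ring.
rewrite ay k_cver E cosD cth sth -/c -/d.
have -> : k * cy q = 1 - (c ^+ 2 + d ^+ 2) * X by rewrite cs /X; ring.
by ring.
Qed.

Lemma range_arc : range (circle_arc k p n) = on_conic.
Proof.
apply/seteqP; split => [_ [s _ <-]|q cq]; first exact: arc_on_conic.
have [k0|k0] := eqVneq k 0.
  exists (cx q) => //; have [ax ay] := coords_arc (cx q); apply: coords_inj.
    by rewrite ax /csin k0 eqxx.
  rewrite ay /cver k0 eqxx; move/on_conicE : cq; rewrite k0 mul0r => E; lra.
have [->|ne] := pselect (q = circle_arc k p n 0); first by exists 0.
by have [s [_ ->]] := conic_arc_shift k0 cq ne; exists s.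
Qed.

Lemma arc_circle : circle_of_curvature k (range (circle_arc k p n)).
Proof.
rewrite range_arc; split => [k0|k0].
  exists (p + k^-1 *: n); apply/seteqP.
  have e : `|k|^-1 ^+ 2 = k^-1 ^+ 2 by rewrite -normfV real_normK ?num_real.
  have I q : dot2 (q - (p + k^-1 *: n)) (q - (p + k^-1 *: n)) =
      dot2 (q - p) (q - p) - k^-1 * (2 * dot2 n (q - p)) + k^-1 ^+ 2.
    by rewrite -[k^-1 ^+ 2]mulr1 -[X in _ + _ * X]n_unit /dot2 !mxE; ring.
  split => q; rewrite /round_circle /on_conic /= I e => E; first by rewrite -E; field.
  have -> : dot2 (q - p) (q - p) = k^-1 * (2 * dot2 n (q - p)) by lra.
  by rewrite mulVKf.
exists p, (row2 (n 0 1) (- n 0 0)); split.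
  apply/eqP => /rowP e; have := n_unit; have := e 0; have := e 1; rewrite !mxE /=.
  by move=> /eqP; rewrite oppr_eq0 => /eqP -> ->; rewrite expr0n addr0 => /eqP; rewrite eq_sym oner_eq0.
rewrite -range_arc; apply/seteqP; split => [_ [s _ <-]|_ [s _ <-]]; exists s => //;
  apply: row2P; rewrite /circle_arc /frame_comb /csin /cver k0 eqxx !mxE /=; ring.
Qed.

End Arc.

(** A chord of the conic is orthogonal to the sum of the normals at its ends. Equal tangential
    coordinates make the chord a multiple of [nu], on which both normals are positive, so the chord
    is zero. *)
Lemma conic_unique (R : realType) (k : R) (p n nu q r : 'rV[R]_2) :
  on_conic k p n q -> on_conic k p n r -> nu 0 0 ^+ 2 + nu 0 1 ^+ 2 = 1 ->
  0 < dot2 (n - k *: (q - p)) nu -> 0 < dot2 (n - k *: (r - p)) nu ->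
  q 0 0 * nu 0 1 - q 0 1 * nu 0 0 = r 0 0 * nu 0 1 - r 0 1 * nu 0 0 -> q = r.
Proof.
rewrite /on_conic /dot2 !mxE => cq cr nu1 hq hr e.
set x := (r 0 0 - q 0 0) * nu 0 0 + (r 0 1 - q 0 1) * nu 0 1.
set z := (r 0 0 - q 0 0) * nu 0 1 - (r 0 1 - q 0 1) * nu 0 0.
have z0 : z = 0 by rewrite /z; lra.
have E0 : r 0 0 - q 0 0 = x * nu 0 0.
  transitivity ((r 0 0 - q 0 0) * (nu 0 0 ^+ 2 + nu 0 1 ^+ 2)); first by rewrite nu1 mulr1.
  transitivity (x * nu 0 0 + z * nu 0 1); first by rewrite /x /z; ring.
  by rewrite z0 mul0r addr0.
have E1 : r 0 1 - q 0 1 = x * nu 0 1.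
  transitivity ((r 0 1 - q 0 1) * (nu 0 0 ^+ 2 + nu 0 1 ^+ 2)); first by rewrite nu1 mulr1.
  transitivity (x * nu 0 1 - z * nu 0 0); first by rewrite /x /z; ring.
  by rewrite z0 mul0r subr0.
move: hq hr; set hq := (X in 0 < X -> _) => hq0; set hr := (X in 0 < X -> _) => hr0.
have xh : x * (hq + hr) = 0.
  transitivity ((n 0 0 - k * (q 0 0 - p 0 0) + (n 0 0 - k * (r 0 0 - p 0 0))) * (x * nu 0 0) +
   (n 0 1 - k * (q 0 1 - p 0 1) + (n 0 1 - k * (r 0 1 - p 0 1))) * (x * nu 0 1)).
    by rewrite /hq /hr; ring.
  rewrite -E0 -E1.
  transitivity ((2 * (n 0 0 * (r 0 0 - p 0 0) + n 0 1 * (r 0 1 - p 0 1))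
     - k * ((r 0 0 - p 0 0) * (r 0 0 - p 0 0) + (r 0 1 - p 0 1) * (r 0 1 - p 0 1)))
    - (2 * (n 0 0 * (q 0 0 - p 0 0) + n 0 1 * (q 0 1 - p 0 1))
     - k * ((q 0 0 - p 0 0) * (q 0 0 - p 0 0) + (q 0 1 - p 0 1) * (q 0 1 - p 0 1)))); first by ring.
  by rewrite cq cr; ring.
have x0 : x = 0.
  by move/eqP : xh; rewrite mulf_eq0 (gt_eqF (addr_gt0 hq0 hr0)) orbF => /eqP.
by apply: row2P; apply/esym/subr0_eq; rewrite ?E0 ?E1 x0 mul0r.
Qed.

Lemma dot2_affine (R : realType) (k : R) (n p q nu : 'rV[R]_2) :
  dot2 (n - k *: (q - p)) nu =
  (n 0 0 - k * (q 0 0 - p 0 0)) * nu 0 0 + (n 0 1 - k * (q 0 1 - p 0 1)) * nu 0 1.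
Proof. by rewrite /dot2 !mxE. Qed.

Lemma sin_sign (R : realType) (v : R) : - pi < v < pi -> v != 0 -> 0 < sin v * v.
Proof.
move=> /andP[v1 v2]; case: (ltgtP v 0) => // v0 _.
  by rewrite -mulrNN -sinN mulr_gt0 ?oppr_gt0 // sin_gt0_pi // oppr_gt0 v0 /= ltrNl.
by rewrite mulr_gt0 // sin_gt0_pi // v0.
Qed.

(** * The image is a vertical cylinder over an arc of the conic *)

Section Final.
Variables (R : realType) (tau lambda : R) (T : topologicalType) (F N : T -> 'rV[R]_3).
Hypotheses (surfF : oriented_surface tau F N) (transF : translator tau lambda F N)
  (invF : vertically_invariant (range F)).
Variable q0 : T.

Let k := 2 * lambda.
Let p := nil_proj (F q0).
Let n := nil_proj (N q0).
Let a := circle_arc k p n.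
Let g q := nil_proj (F q).

Let n1 : n 0 0 ^+ 2 + n 0 1 ^+ 2 = 1.
Proof.
by rewrite /n (nil_projE _).1 (nil_projE _).2; exact: (normal_planar_unit surfF invF).
Qed.

Lemma gauss_affine q : nil_proj (N q) = n - k *: (g q - p).
Proof.
have [e0 e1] := global_translate surfF transF invF q q0.
apply: row2P.
  rewrite (nil_projE (N q)).1 /n /g /p ![in RHS]mxE.
  move: (nil_projE (N q0)) (nil_projE (F q0)) (nil_projE (F q)); rewrite !mxE => -[-> _] [-> _] [-> _].
  by rewrite /k; lra.
rewrite (nil_projE (N q)).2 /n /g /p ![in RHS]mxE.
move: (nil_projE (N q0)) (nil_projE (F q0)) (nil_projE (F q)); rewrite !mxE => -[_ ->] [_ ->] [_ ->].
by rewrite /k; lra.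
Qed.

Lemma proj_on_conic q : on_conic k p n (g q).
Proof.
have WE q' := global_translate surfF transF invF q' q0.
have := global_quadric surfF invF WE q q0.
rewrite /on_conic /dot2 /n /g /p.
have [f0 f1] := nil_projE (F q - F q0); have [m0 m1] := nil_projE (N q0).
rewrite nil_projB f0 f1 m0 m1 !mxE /k => E.
by apply: subr0_eq; move/eqP: E; rewrite -subr_eq0 => /eqP <-; ring.
Qed.

Lemma proj_arc q : exists s, a s = g q.
Proof.
have : range a (g q) by rewrite /a (range_arc k p n1); exact: proj_on_conic.
by move=> [s _ <-]; exists s.
Qed.

Lemma range_fiber x : range F x <-> range g (nil_proj x).
Proof.
split => [[q _ <-]|[q _ gx]]; first by exists q.
rewrite -(invF (x 0 2 - F q 0 2)); exists (F q); first by exists q.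
have [e0 e1] : F q 0 0 = x 0 0 /\ F q 0 1 = x 0 1.
  rewrite -(nil_projE (F q)).1 -(nil_projE (F q)).2 -/(g q) gx.
  by rewrite (nil_projE x).1 (nil_projE x).2.
apply/rowP; apply: forall_I3; rewrite /vertical_translation !mxE /=.
- by rewrite e0 mulr0 addr0.
- by rewrite e1 mulr0 addr0.
- by rewrite mulr1 addrC subrK.
Qed.

Let Sset := [set s | range g (a s)].

Let acont s : {for s, continuous a}.
Proof.
by apply: differentiable_continuous; apply/derivable1_diffP; have [] := arc_deriv k p n s.
Qed.

Let acoord (i : 'I_2) s : {for s, continuous (fun s => a s 0 i)}.
Proof. exact: (continuous_comp (@acont s) (@coord_continuous R 1 2 0 i (a s))). Qed.

Let coord_cont (G : T -> 'rV[R]_3) (i : 'I_3) q : continuous G ->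
  {for q, continuous (fun q => G q 0 i)}.
Proof. by move=> cG; exact: (continuous_comp (cG q) (@coord_continuous R 1 3 0 i (G q))). Qed.

(** For s' near s, [tangential_surjective] gives a point q' whose projection has the same tangential
    coordinate as a s'. Both lie on the conic with normals close to the one at q, so [conic_unique]
    identifies them. *)
Lemma open_preimage : open Sset.
Proof.
rewrite openE => s [q _ gq].
have nuE := gauss_affine q; set nu := nil_proj (N q) in nuE.
have [nu0 nu1] := nil_projE (N q); rewrite -/nu in nu0 nu1.
have nuu : nu 0 0 ^+ 2 + nu 0 1 ^+ 2 = 1.
  by rewrite nu0 nu1; exact: (normal_planar_unit surfF invF).
(* Points whose normal makes an acute angle with [nu], as [conic_unique] requires. *)
pose A := [set q' | 0 < N q' 0 0 * nu 0 0 + N q' 0 1 * nu 0 1].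
have nA : nbhs q A.
  have c : N q' 0 0 * nu 0 0 + N q' 0 1 * nu 0 1 @[q' --> q] --> N q 0 0 * nu 0 0 + N q 0 1 * nu 0 1.
    have c0 := coord_cont (i := 0) (q := q) (normal_continuous surfF).
    have c1 := coord_cont (i := 1) (q := q) (normal_continuous surfF).
    exact: (cvgD (cvgM c0 (cvg_cst (nu 0 0))) (cvgM c1 (cvg_cst (nu 0 1)))).
  apply: (cvgr_gt _ c); rewrite -nu0 -nu1 -!expr2 nuu; exact: ltr01.
have [e e0 eP] := tangential_surjective surfF invF nA.
pose ph s' := a s' 0 0 * nu 0 1 - a s' 0 1 * nu 0 0.
have cph : ph s' @[s' --> s] --> ph s.
  exact: (cvgB (cvgM (acoord (i := 0) (s := s)) (cvg_cst (nu 0 1))) (cvgM (acoord (i := 1) (s := s)) (cvg_cst (nu 0 0)))).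
pose ps s' := dot2 (n - k *: (a s' - p)) nu.
have cps : ps s' @[s' --> s] --> ps s.
  rewrite /ps; under eq_fun do rewrite dot2_affine.
  rewrite dot2_affine.
  have cn (i : 'I_2) : (n 0 i - k * (a s' 0 i - p 0 i)) * nu 0 i @[s' --> s] -->
      (n 0 i - k * (a s 0 i - p 0 i)) * nu 0 i.
    exact: (cvgM (cvgB (cvg_cst (n 0 i)) (cvgM (cvg_cst k) (cvgB (acoord (i := i) (s := s)) (cvg_cst (p 0 i)))))
      (cvg_cst (nu 0 i))).
  exact: (cvgD (cn 0) (cn 1)).
have ps1 : ps s = 1 by rewrite /ps -gq -nuE /dot2 -!expr2.
have phq : ph s = F q 0 0 * N q 0 1 - F q 0 1 * N q 0 0.
  by rewrite /ph -gq /g (nil_projE _).1 (nil_projE _).2 nu0 nu1.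
near=> s'.
have d1 : `|ph s' - (F q 0 0 * N q 0 1 - F q 0 1 * N q 0 0)| < e.
  rewrite -phq distrC; near: s'.
  by move/cvgrPdist_lt : cph; apply.
have d2 : 0 < ps s' by near: s'; apply: (cvgr_gt _ cps); rewrite ps1 ltr01.
have [q' Aq' fq'] := eP _ d1.
exists q' => //; apply: (conic_unique (nu := nu) (proj_on_conic q') (arc_on_conic k p n1 s') nuu _ d2).
  have := Aq'; rewrite -gauss_affine /dot2 /A /=.
  by have [-> ->] := nil_projE (N q').
move: fq'; rewrite -nu0 -nu1 /g; have [-> ->] := nil_projE (F q').
by rewrite /ph.
Unshelve. all: by end_near. Qed.

Lemma closed_preimage : closed (range F) -> closed Sset.
Proof.
move=> cF; pose b (s : R) : 'rV[R]_3 := \row_i (if i == 0 then a s 0 0 else if i == 1 then a s 0 1 else 0).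
have bc : continuous b.
  move=> s; apply: differentiable_continuous; apply/derivable1_diffP/derivable_mxP => i j.
  have [d _] := arc_deriv k p n s; have /derivable_mxP dc := d.
  rewrite ord1; move: j; apply: forall_I3.
  - have -> : (fun x => b x 0 0) = (fun x => a x 0 0) by apply/funext => x; rewrite mxE.
    exact: dc.
  - have -> : (fun x => b x 0 1) = (fun x => a x 0 1) by apply/funext => x; rewrite mxE.
    exact: dc.
  - have -> : (fun x => b x 0 2) = cst 0 by apply/funext => x; rewrite mxE.
    exact: derivable_cst.
have -> : Sset = b @^-1` range F.
  have bE s : nil_proj (b s) = a s.
    by apply: row2P; have [e0 e1] := nil_projE (b s); rewrite ?e0 ?e1 mxE.
  apply/seteqP; split => s /= h; first by apply/range_fiber; rewrite bE.
  by rewrite /Sset /= -bE; apply/range_fiber.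
by apply: preimage_closed cF => s _; exact: bc.
Qed.

Lemma planar_interval (al be ga : R) :
  is_interval (range (fun q => al * F q 0 0 + be * F q 0 1 + ga)).
Proof.
have cF : continuous F by exact: (surface_continuous surfF).
apply/connected_intervalP; apply: connected_continuous_connected.
  exact: surface_connected surfF.
apply: continuous_subspaceT => q.
exact: (cvgD (cvgD (cvgM (cvg_cst al) (coord_cont (i := 0) (q := q) cF))
  (cvgM (cvg_cst be) (coord_cont (i := 1) (q := q) cF))) (cvg_cst ga)).
Qed.

Lemma preimage_image (J : set R) : J `<=` Sset ->
  (forall q, exists2 s, J s & a s = g q) -> a @` J = range g.
Proof.
move=> JS Jg; apply/seteqP; split => [_ [s Js <-]|_ [q _ <-]]; first exact: JS.
by have [s Js as_] := Jg q; exists s.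
Qed.

Lemma flat_interval : k = 0 -> is_interval Sset.
Proof.
move=> k0.
have E q : (g q - p) 0 0 * n 0 1 - (g q - p) 0 1 * n 0 0 =
    n 0 1 * F q 0 0 + (- n 0 0) * F q 0 1 + (p 0 1 * n 0 0 - p 0 0 * n 0 1).
  have [e0 e1] := nil_projE (F q); rewrite -e0 -e1 -/(g q).
  have -> : (g q - p) 0 0 = g q 0 0 - p 0 0 by rewrite [LHS]mxE [X in _ + X]mxE.
  have -> : (g q - p) 0 1 = g q 0 1 - p 0 1 by rewrite [LHS]mxE [X in _ + X]mxE.
  by ring.
have sE s q : a s = g q -> s = n 0 1 * F q 0 0 + (- n 0 0) * F q 0 1 + (p 0 1 * n 0 0 - p 0 0 * n 0 1).
  move=> as_; rewrite -E -as_; have [-> _] := coords_arc k p n1 s.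
  by rewrite /csin k0 eqxx.
(* On a line the parameter is itself an affine function of the point. *)
have -> : Sset = range (fun q => n 0 1 * F q 0 0 + (- n 0 0) * F q 0 1 + (p 0 1 * n 0 0 - p 0 0 * n 0 1)).
  apply/seteqP; split => [s [q _ gq]|_ [q _ <-]].
    by exists q => //; rewrite -(sE s).
  by have [s as_] := proj_arc q; exists q => //; rewrite -(sE _ _ as_).
exact: planar_interval.
Qed.

(* The chord through a s0 and a s2 separates the circle into two pieces; a     *)
(* connected image meeting both and avoiding a s0 has to pass through a s2.    *)
Lemma arc_interval (s0 : R) : k != 0 -> ~ Sset s0 ->
  is_interval (Sset `&` [set s | 0 < k * (s - s0) < pi *+ 2]).
Proof.
move=> k0 nS s1 s3 [S1 /= w1] [S3 /= w3] s2 /andP[l1 l3].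
have w2 : 0 < k * (s2 - s0) < pi *+ 2.
  case/andP: w1 => a1 b1; case/andP: w3 => a3 b3.
  case: (ltgtP k 0) k0 => // kk _; apply/andP; split.
  - by apply: lt_le_trans a3 _; rewrite ler_nM2l // lerD2r.
  - by apply: le_lt_trans b1; rewrite ler_nM2l // lerD2r.
  - by apply: lt_le_trans a1 _; rewrite ler_pM2l // lerD2r.
  - by apply: le_lt_trans b3; rewrite ler_pM2l // lerD2r.
split => //; apply: contrapT => nS2.
(* In angles about the centre, [mid] bisects the chord and [hf] is half its opening. The affine
   function [l] equals cos (k s - mid) - cos hf, which vanishes on the chord and factors into two
   sines. *)
pose mid := k * (s0 + s2) / 2; pose hf := k * (s2 - s0) / 2.
pose al := (- k * n 0 0) * cos mid + k * n 0 1 * sin mid.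
pose be := (- k * n 0 1) * cos mid - k * n 0 0 * sin mid.
pose ga := cos mid - cos hf - al * p 0 0 - be * p 0 1.
pose l q := al * F q 0 0 + be * F q 0 1 + ga.
have lE q s : a s = g q -> l q = - 2 * (sin (k * (s - s0) / 2) * sin (k * (s - s2) / 2)).
  move=> as_.
  transitivity ((1 - k * cver k s) * cos mid + k * csin k s * sin mid - cos hf).
    have [<- <-] := coords_arc k p n1 s; rewrite -/a as_.
    have -> : (g q - p) 0 0 = F q 0 0 - p 0 0.
      by rewrite [LHS]mxE [X in _ + X]mxE /g (nil_projE (F q)).1.
    have -> : (g q - p) 0 1 = F q 0 1 - p 0 1.
      by rewrite [LHS]mxE [X in _ + X]mxE /g (nil_projE (F q)).2.
    by rewrite /l /ga /al /be; ring.
  rewrite k_cver k_csin subKr.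
  have -> : k * s = (k * (s - s0) / 2 + k * (s - s2) / 2) + mid by rewrite /mid; field.
  have -> : hf = k * (s - s0) / 2 - k * (s - s2) / 2 by rewrite /hf; field.
  set u := k * (s - s0) / 2; set v := k * (s - s2) / 2.
  rewrite cosB (cosD (u + v)) (sinD (u + v)) cosD.
  have c := cos2Dsin2 mid.
  transitivity ((cos u * cos v - sin u * sin v) * (cos mid ^+ 2 + sin mid ^+ 2)
    - (cos u * cos v + sin u * sin v)); first by ring.
  by rewrite c; ring.
have sinu s : 0 < k * (s - s0) < pi *+ 2 -> 0 < sin (k * (s - s0) / 2).
  by rewrite mulr2n => /andP[h1 h2]; apply: sin_gt0_pi; apply/andP; split; lra.
have vI s : 0 < k * (s - s0) < pi *+ 2 -> - pi < k * (s - s2) / 2 < pi.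
  move=> /andP[h1 h2]; case/andP: w2 => h3 h4; rewrite mulr2n in h2 h4.
  have -> : k * (s - s2) / 2 = k * (s - s0) / 2 - k * (s2 - s0) / 2 by field.
  by apply/andP; split; lra.
(* In the window the first sine is positive and the second has the sign of k (s - s2), so the sign
   of [l] tells on which side of s2 the point lies. *)
have sgn s q : a s = g q -> 0 < k * (s - s0) < pi *+ 2 -> s != s2 ->
    0 < l q * (k * (s2 - s)).
  move=> as_ w ns; rewrite (lE q s as_).
  have v0 : k * (s - s2) / 2 != 0 by rewrite mulf_neq0 ?invr_eq0 ?pnatr_eq0 // mulf_neq0 // subr_eq0.
  have h := sin_sign (vI s w) v0.
  have -> : - 2 * (sin (k * (s - s0) / 2) * sin (k * (s - s2) / 2)) * (k * (s2 - s)) =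
    4 * (sin (k * (s - s0) / 2) * (sin (k * (s - s2) / 2) * (k * (s - s2) / 2))) by field.
  by rewrite mulr_gt0 // mulr_gt0 //; exact: sinu.
have [q1 _ gq1] := S1; have [q3 _ gq3] := S3.
have n12 : s1 != s2 by apply: contra_not_neq nS2 => <-.
have n32 : s3 != s2 by apply: contra_not_neq nS2 => <-.
have g1 := sgn s1 q1 (esym gq1) w1 n12; have g3 := sgn s3 q3 (esym gq3) w3 n32.
have l12 : 0 < s2 - s1 by rewrite subr_gt0 lt_neqAle n12.
have l23 : s2 - s3 < 0 by rewrite subr_lt0 lt_neqAle eq_sym n32.
have [q _ lq] : range l 0.
  have Il := @planar_interval al be ga.
  case: (ltgtP k 0) k0 => // kk _.
    apply: (Il (l q1) (l q3)); [by exists q1|by exists q3|].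
    rewrite nmulr_lgt0 in g1; last by rewrite nmulr_rlt0.
    rewrite pmulr_lgt0 in g3; last by rewrite nmulr_rgt0.
    by rewrite !ltW.
  apply: (Il (l q3) (l q1)); [by exists q3|by exists q1|].
  rewrite pmulr_lgt0 in g1; last by rewrite pmulr_rgt0.
  rewrite nmulr_lgt0 in g3; last by rewrite pmulr_rlt0.
  by rewrite !ltW.
have [|s [w gq]] := conic_arc_shift n1 k0 (proj_on_conic q) (s0 := s0).
  by move=> e; apply: nS; exists q.
have [ss|ss] := eqVneq s s2; first by apply: nS2; exists q => //; rewrite -ss.
by have := sgn s q (esym gq) w ss; rewrite lq mul0r ltxx.
Qed.

Lemma image_interval : exists J : set R, [/\ is_interval J, open J, J !=set0,
  a @` J = range g & closed (range F) -> a @` J = range a].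
Proof.
have [ST|/existsNP[s0 nS]] := pselect (forall s, Sset s).
  have E : a @` [set: R] = range g.
    by apply: preimage_image => [s _|q]; [exact: ST|have [s as_] := proj_arc q; exists s].
  exists [set: R]; split => //; first exact: openT.
  by exists 0.
(* Otherwise [Sset] would be open, closed and nonempty in the line, hence contain s0. *)
have ncl : ~ closed (range F).
  move=> /closed_preimage cS; apply: nS.
  have : connected [set: R] by apply/connected_intervalP.
  move=> /(_ Sset) -> //.
  - by have [s as_] := proj_arc q0; exists s; exists q0.
  - by exists Sset; [exact: open_preimage|rewrite setTI].
  - by exists Sset; [|rewrite setTI].
have [k0|k0] := eqVneq k 0.
  exists Sset; split; last by move=> /ncl.
  - exact: flat_interval.
  - exact: open_preimage.
  - by have [s as_] := proj_arc q0; exists s; exists q0.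
  - by apply: preimage_image => // q; have [s as_] := proj_arc q; exists s => //; exists q.
have shift q : exists2 s, (Sset `&` [set s | 0 < k * (s - s0) < pi *+ 2]) s & a s = g q.
  have [|s [w gq]] := conic_arc_shift n1 k0 (proj_on_conic q) (s0 := s0).
    by move=> e; apply: nS; exists q.
  by exists s => //; split => //; exists q.
(* [Sset] is periodic and misses s0; one period starting at s0 already reaches every point of the
   image. *)
exists (Sset `&` [set s | 0 < k * (s - s0) < pi *+ 2]); split.
- exact: arc_interval.
- apply: openI; first exact: open_preimage.
  have -> : [set s | 0 < k * (s - s0) < pi *+ 2] =
      (fun s => k * (s - s0)) @^-1` [set` `]0, pi *+ 2[].
    by apply/seteqP; split => s /=; rewrite in_itv.
  apply: open_comp; last exact: interval_open.
  move=> s _; exact: (cvgM (cvg_cst k) (cvgB cvg_id (cvg_cst s0))).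
- by have [s Js _] := shift q0; exists s.
- by apply: preimage_image => // s [].
- by move=> /ncl.
Qed.

Lemma normal_rot90 s q : g q = a s -> nil_proj (N q) = rot90 (derive1 a s).
Proof. by move=> gq; rewrite gauss_affine gq rot90_arc. Qed.

Lemma classification : exists (b : R -> 'rV[R]_2) (J : set R),
  [/\ arclength_curve b /\ (forall s, curvature b s = k),
      circle_of_curvature k (range b),
      [/\ is_interval J, open J & J !=set0],
      range F = vertical_cylinder (b @` J) /\ (closed (range F) -> b @` J = range b) &
      forall s q, J s -> nil_proj (F q) = b s -> nil_proj (N q) = rot90 (derive1 b s)].
Proof.
have [J [iJ oJ J0 aJ cJ]] := image_interval.
exists a, J; split => //.
- split; [exact: arc_arclength|exact: arc_curvature].
- exact: arc_circle.
- split => //; rewrite aJ /vertical_cylinder; apply/seteqP; split => x; by move/range_fiber.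
- by move=> s q _; exact: normal_rot90.
Qed.

End Final.

Theorem proposition3p1 (R : realType) (tau lambda : R) (T : topologicalType)
    (F N : T -> 'rV[R]_3)
    (surfF : oriented_surface tau F N)
    (transF : translator tau lambda F N)
    (invF : vertically_invariant (range F)) :
  exists (a : R -> 'rV[R]_2) (J : set R),
    [/\ arclength_curve a /\ (forall s, curvature a s = 2 * lambda),
        circle_of_curvature (2 * lambda) (range a),
        [/\ is_interval J, open J & J !=set0],
        range F = vertical_cylinder (a @` J) /\
          (closed (range F) -> a @` J = range a) &
        forall s q, J s -> nil_proj (F q) = a s ->
          nil_proj (N q) = rot90 (derive1 a s)].
Proof.
have [q0 _] := surface_nonempty surfF.
exact: (classification surfF transF invF q0).
Qed.
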